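(* Let $\phi$ belong to the Szegő class. Then: (1) $$\frac{D_{r,q}}{D_{r+1,q}}=s_{r,r}\det\Delta(\mathcal{H}_{r,r},\mathcal{H}_{r+1,q})=\frac{s_{r,r}}{|\varphi^\sharp_{q}(0,r)|^2};$$ (2) $$\lim_{q\to\infty}\frac{D_{r,q}}{D_{r+1,q}}=s_{r,r}\det\Delta(\mathcal{H}_{r,r},\mathcal{H}_{r+1,\infty})=|\Theta_\phi(r,r)|^2=s_{r,r}\prod_{j\ge1}d_{r,r+j}^2;$$ (3) if we denote the limit in (2) by $g_r$ and $$L=\lim_{n\to\infty}\ \prod_{0\le k\le n<j}d_{k,j}^2>0,$$ then $$\lim_{n\to\infty}\frac{D_{0,n}}{\prod_{l=0}^n g_l}=\frac{1}{\det\Delta\big(\mathcal{H}_{0,\infty},\bigcap_{n\ge0}\mathcal{H}_{n,\infty}\big)}=\frac1L .$$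
   Context: Let $\mathcal{P}_2$ be the algebra of complex polynomials in two noncommuting indeterminates $X_1,X_2$, with the conjugate-linear involutive anti-automorphism $\mathcal{J}$ determined by $\mathcal{J}(X_1)=X_2$, $\mathcal{J}(X_2)=X_1$. Let $\phi$ be a linear functional on $\mathcal{P}_2$ that is strictly positive: $\phi(\mathcal{J}(P)P)>0$ for every nonzero polynomial $P$ in the single variable $X=X_1$. Put $s_{n,m}=K_\phi(n,m)=\phi(\mathcal{J}(X^n)X^m)$, $n,m\in\mathbb{N}_0=\{0,1,2,\dots\}$. For $r\le q$, $D_{r,q}=\det[s_{r',q'}]_{r\le r',q'\le q}$. Parameters: $\{\gamma_{k,j}\}_{0\le k<j}$ is the unique family of complex numbers with $|\gamma_{k,j}|<1$ such that, with $d_{k,j}=(1-|\gamma_{k,j}|^2)^{1/2}$, for all $k<j$ $$s_{k,j}=s_{k,k}^{1/2}\,(U_{k,j})_{1,1}\,s_{j,j}^{1/2},$$ where $U_{j,j}=1$ and $U_{k,j}=R_{k,k+1}R_{k,k+2}\cdots R_{k,j}(U_{k+1,j}\oplus 1)$ is a matrix of size $m=j-k+1$; here $R_{k,k+i}$ is the $m\times m$ identity matrix with its $2\times2$ block in rows and columns $i,i+1$ replaced by $\begin{bmatrix}\gamma_{k,k+i}& d_{k,k+i}\\ d_{k,k+i}&-\overline{\gamma}_{k,k+i}\end{bmatrix}$. Polynomials: for $n,l\in\mathbb{N}_0$, $\varphi_0(X,l)=\varphi_0^\sharp(X,l)=s_{l,l}^{-1/2}$ and, for $n\ge1$, $$\varphi_n(X,l)=\tfrac{1}{d_{l,n+l}}\big(X\varphi_{n-1}(X,l+1)-\gamma_{l,n+l}\varphi^\sharp_{n-1}(X,l)\big),$$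 $$\varphi^\sharp_n(X,l)=\tfrac{1}{d_{l,n+l}}\big(-\overline{\gamma}_{l,n+l}X\varphi_{n-1}(X,l+1)+\varphi^\sharp_{n-1}(X,l)\big).$$ Spectral factor: for a family $\mathcal{F}=\{\mathcal{F}_n\}_{n\ge0}$ of Hilbert spaces, each $\{0\}$ or $\mathbb{C}$, consider lower triangular arrays $\Theta=[\Theta_{k,j}]_{k,j\ge 0}$ with $\Theta_{k,j}\in\mathcal{F}_k$, $\Theta_{k,j}=0$ for $k<j$, and each column $c_j(\Theta)=[\Theta_{k,j}]_{k\ge0}$ in $\bigoplus_{k\ge j}\mathcal{F}_k$. Such $\Theta$ is outer if for every $k\ge0$ the set $\{c_j(\Theta):j\ge k\}$ is total in $\bigoplus_{j\ge k}\mathcal{F}_j$. Put $K_\Theta(k,j)=c_k(\Theta)^*c_j(\Theta)$, and write $K_1\le K_2$ if $K_2-K_1$ is a positive definite (i.e. positive semidefinite) kernel on $\mathbb{N}_0$. The spectral factor $\Theta_\phi$ of $K_\phi$ is the unique outer array with $K_{\Theta_\phi}\le K_\phi$, with $K_{\Theta'}\le K_{\Theta_\phi}$ for every outer $\Theta'$ (for any such family $\mathcal{F}'$) satisfying $K_{\Theta'}\le K_\phi$, and normalized by $(\Theta_\phi)_{n,n}\ge0$ for all $n$; $\Theta_\phi(r,r)$ denotes the entry $(\Theta_\phi)_{r,r}$. The functional $\phi$ belongs to the Szegő class if $(\Theta_\phi)_{n,n}>0$ for all $n\ge0$; equivalently, $s_{k,k}\prod_{n>k}d_{k,n}>0$ for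 all $k\ge0$. Stochastic process: $\{f_n\}_{n\ge0}\subset L^2(\mu)$, for a probability space $(\Omega,\mathcal{M},\mu)$, is a process with covariance kernel $K_\phi$, i.e. $K_\phi(m,n)=\int_\Omega f_n\overline{f}_m\,d\mu$, and $\{f_n\}_{n\ge0}$ is total in $L^2(\mu)$. For $r\le q\le\infty$, $\mathcal{H}_{r,q}$ is the closed linear span in $L^2(\mu)$ of the $f_k$ with $r\le k\le q$ ($k$ finite). For closed subspaces $\mathcal{E}_1,\mathcal{E}_2$ of $L^2(\mu)$, $\Delta(\mathcal{E}_1,\mathcal{E}_2)=I-P_{\mathcal{E}_1}P_{\mathcal{E}_2}P_{\mathcal{E}_1}$, where $P_{\mathcal{E}}$ is the orthogonal projection of $L^2(\mu)$ onto $\mathcal{E}$. The operator $\Delta(\mathcal{H}_{0,\infty},\bigcap_{n\ge0}\mathcal{H}_{n,\infty})$ is the strong operator limit, as $n\to\infty$, of $\Delta(\mathcal{H}_{0,n},\mathcal{H}_{n+1,\infty})$. In (1) and (2) the indices are integers $0\le r<q$, so that all the quantities are defined.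
   Formalization: In (1) the last member is corrected to 1/|φ♯_{q-r}(0,r)|², as the printed one fails e.g. for r=0, q=1, s_{0,0}≠1; in (3) det Δ(H_{0,∞},∩H_{n,∞}) means the limit of det Δ(H_{0,n},H_{n+1,∞}), as the literal determinant can be 1 while L<1. *)

(* Defs.v *)
From HB Require Import structures.
From mathcomp Require Import all_boot all_order all_algebra.
From mathcomp Require Import all_classical all_reals all_analysis.
From mathcomp.real_closed Require Export complex.
From mathcomp.multinomials Require Export -(notations) monalg.

Set Implicit Arguments.
Unset Strict Implicit.
Unset Printing Implicit Defensive.
Set Warnings "-redundant-canonical-projection".
Import Order.TTheory GRing.Theory Num.Theory.
Import numFieldNormedType.Exports.

Local Open Scope classical_set_scope.
Local Open Scope ring_scope.

(* The usual metric topology of the complex field R[i], with norm [`|x|]. *)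
HB.instance Definition _ (R : realType) :=
  PseudoPointedMetric.copy R[i] (R[i])^o.
HB.instance Definition _ (R : realType) :=
  NormedModule.copy R[i] (R[i])^o.

Section FreeAlgebra.
Variable R : realType.
Local Notation C := R[i].

(* The free algebra is the monoid algebra of the free monoid; the letters X_1
   and X_2 are [ord0] and [ord_max] in ['I_2]. *)
Definition P2 : lalgType C := malg (fmonom 'I_2) C.

Definition X1 : P2 := mkmalgU (fmu (ord0 : 'I_2)) (1 : C).

(* On words, J reverses the order and exchanges the two letters ([rev_ord] is
   the exchange on ['I_2]); on coefficients it is complex conjugation. *)
Definition Jword (w : fmonom 'I_2) : fmonom 'I_2 :=
  FMonom (rev [seq rev_ord i | i <- fmonom_val w]).

Definition J (P : P2) : P2 :=
  \sum_(w <- finmap.enum_fset (msupp P)) mkmalgU (Jword w) (mcoeff w P)^*.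

Definition poly_X1 (p : {poly C}) : P2 := \sum_(i < size p) p`_i *: X1 ^+ i.

Definition strictly_positive (phi : {scalar P2}) : Prop :=
  forall p : {poly C}, p != 0 -> 0 < phi (J (poly_X1 p) * poly_X1 p).

Definition moment (phi : {scalar P2}) (n m : nat) : C :=
  phi (J (X1 ^+ n) * X1 ^+ m).

End FreeAlgebra.

Section Schur.
Variable R : realType.
Local Notation C := R[i].
Implicit Types (s g : nat -> nat -> C) (k j n l r q : nat).

(* The size [q.+1 - r] is that of the index range [r..q], and 0 for
   [q = r.-1], where the determinant is 1. *)
Definition Ddet s r q : C :=
  \det (\matrix_(i < q.+1 - r, j < q.+1 - r) s (r + i)%N (r + j)%N).

Definition defect g k j : C := sqrtC (1 - `|g k j| ^+ 2).

(* The identity of size [m] with the block [[c, e], [e, - c^*]] placed in the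
   0-based rows and columns [p] and [p.+1]. *)
Definition elem_rot m (c e : C) (p : nat) : 'M[C]_m :=
  \matrix_(a, b)
    if (a == p :> nat) && (b == p :> nat) then c
    else if (a == p :> nat) && (b == p.+1 :> nat) then e
    else if (a == p.+1 :> nat) && (b == p :> nat) then e
    else if (a == p.+1 :> nat) && (b == p.+1 :> nat) then - c^*
    else (a == b)%:R.

(* [Umx g k n] is the matrix U_{k,k+n}, of size n + 1. *)
Fixpoint Umx g k n {struct n} : 'M[C]_n.+1 :=
  match n with
  | 0 => 1%:M
  | n'.+1 =>
      (\prod_(p < n'.+1)
         elem_rot n'.+2 (g k (k + p.+1)%N) (defect g k (k + p.+1)%N) p)
      * castmx (addn1 _, addn1 _) (block_mx (Umx g k.+1 n') 0 0 (1%:M : 'M[C]_1))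
  end.

Definition is_parameters s g : Prop :=
  forall k j, (k < j)%N ->
    `|g k j| < 1 /\
    s k j = sqrtC (s k k) * Umx g k (j - k) ord0 ord0 * sqrtC (s j j).

(* The pair (phi_n(X, l), phi^sharp_n(X, l)). *)
Fixpoint ortho_pair s g n l : {poly C} * {poly C} :=
  match n with
  | 0 => let c := ((sqrtC (s l l))^-1)%:P in (c, c)
  | n'.+1 =>
      let u := 'X * (ortho_pair s g n' l.+1).1 in
      let v := (ortho_pair s g n' l).2 in
      let c := g l (n'.+1 + l)%N in
      let e := defect g l (n'.+1 + l)%N in
      (e^-1 *: (u - c *: v), e^-1 *: (- (c^* *: u) + v))
  end.

Definition ophi s g n l : {poly C} := (ortho_pair s g n l).1.
Definition ophi_sharp s g n l : {poly C} := (ortho_pair s g n l).2.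

Definition infprod (u : nat -> C) : C := limn (fun n => \prod_(i < n) u i).

End Schur.

Section SpectralFactor.
Variable R : realType.
Local Notation C := R[i].
Implicit Types (K : nat -> nat -> C) (F : pred nat) (Theta : nat -> nat -> C).

Definition pos_kernel K : Prop :=
  forall n (c : nat -> C),
    0 <= \sum_(i < n) \sum_(j < n) (c i)^* * K i j * c j.

Definition le_kernel (K1 K2 : nat -> nat -> C) : Prop :=
  pos_kernel (fun i j => K2 i j - K1 i j).

(* A family of spaces, each {0} or the complex line, is the set [F] of the
   indices at which the space is not {0}; [in_dsum F k v] says that [v] is in
   the Hilbert direct sum of the spaces of index at least [k]. *)
Definition in_dsum F k (v : nat -> C) : Prop :=
  (forall i, ~~ (F i && (k <= i)%N) -> v i = 0) /\
  cvgn (series (fun i => `|v i| ^+ 2)).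

Definition l2norm (v : nat -> C) : C :=
  sqrtC (limn (series (fun i => `|v i| ^+ 2))).

Definition column Theta j : nat -> C := fun k => Theta k j.

Definition lower_triangular F Theta : Prop :=
  forall j, in_dsum F j (column Theta j).

Definition outer F Theta : Prop :=
  lower_triangular F Theta /\
  forall k v, in_dsum F k v -> forall eps : C, 0 < eps ->
    exists n (c : nat -> C),
      l2norm (fun i => v i - \sum_(j < n | (k <= j)%N) c j * column Theta j i)
        < eps.

Definition kernel_of Theta k j : C :=
  limn (series (fun i => (column Theta k i)^* * column Theta j i)).

Definition spectral_factor K F Theta : Prop :=
  [/\ outer F Theta,
      le_kernel (kernel_of Theta) K,
      (forall F' Theta', outer F' Theta' -> le_kernel (kernel_of Theta') K ->
         le_kernel (kernel_of Theta') (kernel_of Theta)) &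
      forall n, 0 <= Theta n n].

Definition szego_class Theta : Prop := forall n, 0 < Theta n n.

End SpectralFactor.

(* Elements of the complex space L^2(mu) are represented by functions, and
   equality in L^2(mu) is almost everywhere equality. *)
Section L2.
Context (R : realType) (d : measure_display) (Omega : measurableType d).
Variable mu : probability Omega R.
Local Notation C := R[i].
Implicit Types (f : nat -> Omega -> C) (g h : Omega -> C).
Implicit Types (E : set (Omega -> C)) (A : (Omega -> C) -> Omega -> C).

Definition L2 g : Prop :=
  (fun x => complex.Re (g x)) \in Lfun mu 2%:E /\
  (fun x => complex.Im (g x)) \in Lfun mu 2%:E.

Definition integralC g : C :=
  Complex (\int[mu]_x complex.Re (g x)) (\int[mu]_x complex.Im (g x)).

Definition inner g h : C := integralC (fun x => g x * (h x)^*).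

Definition L2norm g : C := sqrtC (inner g g).

Definition closed_span f (I : pred nat) : set (Omega -> C) :=
  [set g | L2 g /\ forall eps : C, 0 < eps ->
     exists n (c : nat -> C),
       L2norm (fun x => g x - \sum_(k < n | I k) c k * f k x) < eps].

Definition Hspan f r q := closed_span f [pred k | (r <= k <= q)%N].
Definition Hspan_inf f r := closed_span f [pred k | (r <= k)%N].

Definition is_process (K : nat -> nat -> C) f : Prop :=
  [/\ forall n, L2 (f n),
      forall m n, K m n = inner (f n) (f m) &
      forall g, L2 g -> Hspan_inf f 0 g].

Definition proj E g : Omega -> C :=
  xget (fun=> 0) [set h | E h /\
    forall e, E e -> inner (fun x => g x - h x) e = 0].

Definition Delta E1 E2 : (Omega -> C) -> Omega -> C :=
  fun g x => g x - proj E1 (proj E2 (proj E1 g)) x.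

(* The determinant of an operator A such that A - I has finite rank: that of
   the matrix of A on a finite-dimensional space, with orthonormal basis [e],
   that contains the range of A - I.  It does not depend on the choice of [e]. *)
Definition has_det A (z : C) : Prop :=
  exists n (e : 'I_n -> Omega -> C),
    [/\ (forall i, L2 (e i)),
        (forall i j, inner (e i) (e j) = (i == j)%:R),
        (forall g, L2 g -> {ae mu, forall x,
           A g x - g x
           = \sum_(i < n) inner (fun y => A g y - g y) (e i) * e i x}) &
        z = \det (\matrix_(i, j) inner (A (e j)) (e i))].

Definition detL2 A : C := xget 0 [set z | has_det A z].

Definition strong_cvg (An : nat -> (Omega -> C) -> Omega -> C) A : Prop :=
  forall g, L2 g ->
    (fun n => L2norm (fun x => An n g x - A g x)) @ \oo --> (0 : C).

(* The determinant of a strong limit A of operators An that differ from I by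
   operators of finite rank, taken along that sequence, i.e. as the limit of
   the determinants of the An.  The determinant is not continuous for the
   strong operator topology, so it depends on the sequence and not only on
   A. *)
Definition has_det_along (An : nat -> (Omega -> C) -> Omega -> C) A (z : C)
    : Prop :=
  strong_cvg An A /\ (fun n => detL2 (An n)) @ \oo --> z.

End L2.

(* Main.v *)
From HB Require Import structures.
Require Import Defs.
From mathcomp Require Import all_boot all_order all_algebra.
From mathcomp Require Import all_classical all_reals all_analysis.
From mathcomp Require Import measurable_realfun.
From mathcomp Require Import ring lra zify.
Set Implicit Arguments.
Unset Strict Implicit.
Unset Printing Implicit Defensive.
Import Order.TTheory GRing.Theory Num.Theory.
Import numFieldNormedType.Exports.
Local Open Scope classical_set_scope.
Local Open Scope ring_scope.

(** Throughout, the innovation of f_l relative to a set Q of indices is the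
    residue of f_l after projection on the closed span of the later f_k with k
    in Q, and the prediction error is its squared norm.  Write e(l, q) for the
    error when Q consists of the indices up to q, and e(l) when Q is everything.
    All the quantities of the theorem are products of such errors.

    Determinants.  Innovations are orthogonal, and f_r, ..., f_q expand in them
    with a unitriangular matrix, so their Gram determinant D_{r,q} is the product
    of the e(l, q), r <= l <= q; hence D_{r,q} / D_{r+1,q} = e(r, q).  The same
    expansion, with the full index set and stopped at n, gives the Gram
    determinant of the residues (I - P2) f_0, ..., (I - P2) f_n, with P2 the
    projection on the span of the future, as the product of the e(l).  If P1 is
    the projection on the span of f_0, ..., f_n, then in an orthonormal basis of
    that span the matrix of I - P1 P2 P1 is the Gram matrix of the residues of
    the basis, so det (I - P1 P2 P1) is the quotient of the two Gram determinants
    ([gram_innov], [det_sandwich_innov]).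

    Parameters.  U_{k,j} is a product of plane rotations.  Applying the rotations
    to the first basis vector produces vectors whose Gram matrix is the normalized
    moment matrix and which are upper triangular with products of defects on the
    diagonal.  This gives e(r, q) as s_{r,r} times the product of the squared
    defects d_{r,j}, r < j <= q ([Ddet_ratio_parameters]); the constant term of
    the sharp polynomial is the inverse square root of the same product.

    Spectral factor.  |Theta_{r,r}|^2 = e(r).  Since the columns after r vanish in
    row r, the inequality of kernels tested on f_r minus later f_k gives <=.
    Conversely the coefficients of the f_j along the innovation of f_r form a
    single row which is itself an outer minorant of the kernel; maximality of
    Theta, tested on combinations of columns close to Theta_{r,r} times a basis
    vector, gives >= ([spectral_factor_innov]).

    Limits.  e(r, q) decreases to e(r), which gives (2).  For (3), both
    D_{0,n} / (g_0 ... g_n) and the inverse of det Delta(H_{0,n}, H_{n+1,oo}) are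
    the product of the e(k, n) / e(k), k <= n, that is, the inverse of the product
    of the squared defects d_{k,j}^2, k <= n < j.  Strong convergence of the
    operators follows from that of monotone sequences of projections
    ([qcvg_sandwich]).

    The Hilbert space arguments are made for a complete semi-inner product, so
    that square integrable functions need not be identified almost everywhere;
    completeness of L^2 is the Riesz-Fischer theorem ([rip_complete]). *)

(** * Moments and Schur parameters *)

Section SchurParameters.
Variable R : realType.
Local Notation C := R[i].
Implicit Types (s g : nat -> nat -> C) (v w : nat -> C).

(** The rotation of [elem_rot], acting on infinite sequences: working with
    sequences avoids relating matrices of different sizes. *)
Definition givens (c e : C) (p : nat) v : nat -> C := fun a =>
  if a == p then c * v p + e * v p.+1
  else if a == p.+1 then e * v p - c^* * v p.+1 else v a.

Definition pairing m v w : C := \sum_(a < m) (v a)^* * w a.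

Lemma pairing_givens m c e p v w : (p.+1 < m)%N -> e^* = e ->
  `|c| ^+ 2 + e ^+ 2 = 1 ->
  pairing m (givens c e p v) (givens c e p w) = pairing m v w.
Proof.
move=> pm ereal ce1; have pm' : (p < m)%N := ltnW pm.
have neq : Ordinal pm != Ordinal pm' by rewrite -val_eqE /= eqn_leq ltnn.
have split2 (F : 'I_m -> C) : \sum_i F i = F (Ordinal pm') + F (Ordinal pm)
    + \sum_(i | (i != Ordinal pm') && (i != Ordinal pm)) F i.
  by rewrite (bigD1 (Ordinal pm')) // (bigD1 (Ordinal pm)) //= addrA.
rewrite /pairing !split2 /=.
congr (_ + _); last first.
  apply: eq_bigr => i /andP[]; rewrite -!val_eqE /= /givens => /negbTE-> /negbTE->.
  by [].
rewrite /givens eqxx /= eqn_leq ltnn /= eqxx.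
rewrite !rmorphD rmorphN !rmorphM /= conjCK ereal.
have ce : c * c^* = 1 - e ^+ 2 by rewrite -normCK -ce1 addrK.
transitivity ((c * c^* + e ^+ 2) * ((v p)^* * w p + (v p.+1)^* * w p.+1)).
  ring.
by rewrite ce subrK mul1r.
Qed.

Lemma elem_rot_col m c e p v : (p.+1 < m)%N ->
  elem_rot m c e p *m (\col_i v i) = \col_i givens c e p v i.
Proof.
move=> pm; have pm' : (p < m)%N := ltnW pm.
apply/colP => a; rewrite !mxE /givens.
have neq : Ordinal pm != Ordinal pm' by rewrite -val_eqE /= eqn_leq ltnn.
have off (i : 'I_m) : i != Ordinal pm' -> i != Ordinal pm ->
    ((i == p :> nat) = false) * ((i == p.+1 :> nat) = false).
  by rewrite -!val_eqE /= => /negbTE-> /negbTE->.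
case: (eqVneq (a : nat) p) => [ap|nap] /=.
  rewrite (bigD1 (Ordinal pm')) //= (bigD1 (Ordinal pm)) //= !mxE /=.
  rewrite ap !eqxx /= (gtn_eqF (ltnSn p)) /= big1 ?addr0 // => i /andP[i1 i2].
  have [n1 n2] := off i i1 i2; rewrite !mxE n1 n2 !andbF -val_eqE /=.
  by rewrite ap eq_sym n1 mul0r.
case: (eqVneq (a : nat) p.+1) => [ap|nap1] /=.
  rewrite (bigD1 (Ordinal pm')) //= (bigD1 (Ordinal pm)) //= !mxE /=.
  rewrite ap !eqxx /= (gtn_eqF (ltnSn p)) /= big1 ?addr0 ?mulNr // => i /andP[i1 i2].
  have [n1 n2] := off i i1 i2; rewrite !mxE n1 n2 !andbF -val_eqE /=.
  by rewrite ap eq_sym n2 mul0r.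
rewrite (bigD1 a) //= big1 ?addr0 => [|i ia].
  by rewrite !mxE (negbTE nap) (negbTE nap1) /= eqxx mul1r.
by rewrite !mxE (negbTE nap) (negbTE nap1) /= eq_sym (negbTE ia) mul0r.
Qed.

(** The factors of [Umx g k] at the positions in [l], the last one acting first. *)
Definition givens_seq g k (l : seq nat) v : nat -> C :=
  foldr (fun p => givens (g k (k + p.+1)%N) (defect g k (k + p.+1)%N) p) v l.

(** The vectors h_{k,k+n} = V_k V_{k+1} ... V_{k+n-1} e_0, where V_k is the
    product of the rotations of index k.  Once k is fixed they realize the
    normalized moments from index k on ([moment_schur_vec]). *)
Fixpoint schur_vec g k n : nat -> C :=
  if n is n'.+1 then givens_seq g k (iota 0 n'.+1) (schur_vec g k.+1 n')
  else fun a => (a == 0)%:R.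

Lemma givens_seq_col m g k l v : all (fun p => p.+1 < m)%N l ->
  (\prod_(p <- l) elem_rot m.-1.+1 (g k (k + p.+1)%N) (defect g k (k + p.+1)%N) p)
     *m (\col_i v i) = \col_i givens_seq g k l v i.
Proof.
case: m => [|m]; first by case: l => //= _; rewrite big_nil mul1mx.
elim: l => [|p l IH] /=; first by rewrite big_nil mul1mx.
by case/andP=> pm lm; rewrite big_cons -mulmxA IH // elem_rot_col.
Qed.

Lemma givens_seq_cat g k l1 l2 v : givens_seq g k (l1 ++ l2) v = givens_seq g k l1 (givens_seq g k l2 v).
Proof. by rewrite /givens_seq foldr_cat. Qed.

Lemma givens_seq_out g k l v a : (forall p, p \in l -> (p.+1 < a)%N) -> givens_seq g k l v a = v a.
Proof.
elim: l => //= p l IH h; rewrite /givens.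
have := h p; rewrite inE eqxx => /(_ isT) pa.
rewrite (gtn_eqF pa) (gtn_eqF (ltnW pa)) IH // => q ql.
by apply: h; rewrite inE ql orbT.
Qed.

Lemma givens_seq_id g k n l v : (forall p, p \in l -> (n <= p)%N) ->
  (forall a, (n <= a)%N -> v a = 0) -> givens_seq g k l v =1 v.
Proof.
move=> h v0; elim: l h => //= p l IH h a; rewrite /givens !IH; first last;
  try by move=> q ql; apply: h; rewrite inE ql orbT.
have np : (n <= p)%N by apply: h; rewrite inE eqxx.
case: eqP => [->|_]; first by rewrite !v0 ?(leqW np) // !mulr0 addr0.
case: eqP => [->|_] //; by rewrite !v0 ?(leqW np) // !mulr0 subr0.
Qed.

Lemma eq_givens_seq g k l v w : v =1 w -> givens_seq g k l v =1 givens_seq g k l w.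
Proof. by move/funext->. Qed.

Lemma schur_vecE g k n : schur_vec g k n.+1 = givens_seq g k (iota 0 n.+1) (schur_vec g k.+1 n).
Proof. by []. Qed.

Lemma schur_vec_supp g k n a : (n < a)%N -> schur_vec g k n a = 0.
Proof.
elim: n k a => [|n IH] k a na; first by case: a na.
rewrite schur_vecE givens_seq_out ?IH //.
  exact: ltnW.
by move=> p; rewrite mem_iota /= add0n => pn; apply: leq_ltn_trans na.
Qed.

(** Only the last rotation of each V_i reaches a coordinate that was zero
    before, and it multiplies the leading coordinate by its defect. *)
Lemma schur_vec_lead g k n : schur_vec g k n n = \prod_(i < n) defect g (k + i)%N (k + n)%N.
Proof.
elim: n k => [|n IH] k; first by rewrite big_ord0.
rewrite schur_vecE -addn1 iotaD givens_seq_cat.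
rewrite givens_seq_out /=; last first.
  by move=> p; rewrite mem_iota /= add0n => pn; rewrite addn1 ltnS.
rewrite add0n addn1 /givens (gtn_eqF (ltnSn n)) eqxx (schur_vec_supp _ _ (ltnSn n)) mulr0 subr0 IH.
rewrite big_ord_recl addn0; congr (_ * _); apply: eq_bigr => i _.
by congr (defect g _ _); rewrite ?lift0 /=; lia.
Qed.

(** The rotations beyond position n act on coordinates at which the vector
    vanishes, so one product of fixed length serves for all n < M; this is what
    makes the vectors of different lengths comparable by a common isometry. *)
Lemma schur_vec_widen g k n M : (n < M)%N ->
  schur_vec g k n.+1 = givens_seq g k (iota 0 M) (schur_vec g k.+1 n).
Proof.
move=> nM; rewrite -(subnKC nM) iotaD givens_seq_cat; apply/esym/funext.
apply: eq_givens_seq => a; apply: (@givens_seq_id _ _ n.+1) => [p|b]; last exact: schur_vec_supp.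
by rewrite mem_iota add0n => /andP[].
Qed.

Section Contractive.
Variable g : nat -> nat -> C.
Hypothesis g1 : forall k j, (k < j)%N -> `|g k j| < 1.

Lemma defect_gt0 k j : (k < j)%N -> 0 < defect g k j.
Proof.
move=> kj; rewrite /defect sqrtC_gt0 subr_gt0 expr_lt1 //; exact: g1.
Qed.

Lemma defect_sqr k j : `|g k j| ^+ 2 + defect g k j ^+ 2 = 1.
Proof. by rewrite /defect sqrtCK addrC subrK. Qed.

Lemma pairing_givens_seq m k l v w : all (fun p => p.+1 < m)%N l ->
  pairing m (givens_seq g k l v) (givens_seq g k l w) = pairing m v w.
Proof.
elim: l => //= p l IH /andP[pm /IH <-]; apply: pairing_givens => //.
  apply/CrealP/ger0_real/ltW/defect_gt0; lia.
exact: defect_sqr.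
Qed.

(** Cancel the common isometries V_k, ..., V_{k+n'-1}. *)
Lemma pairing_schur_vec m k n n' : (n' <= n)%N -> (n < m)%N ->
  pairing m (schur_vec g k n') (schur_vec g k n) = schur_vec g (k + n') (n - n') 0.
Proof.
elim: n' n k => [|n' IH] n k nn nm.
  rewrite addn0 subn0 /pairing; case: m nm => // m _.
  rewrite big_ord_recl /= conjC1 mul1r big1 ?addr0 // => i _.
  by rewrite conjC0 mul0r.
case: n nn nm => // n nn nm; rewrite (@schur_vec_widen _ _ n' m.-1) ?(@schur_vec_widen _ _ n m.-1); try lia.
rewrite pairing_givens_seq; first by rewrite IH ?subSS ?addSnnS //; lia.
by apply/allP => p; rewrite mem_iota; lia.
Qed.

Lemma Umx_schur_vec k n (i : 'I_n.+1) : Umx g k n i ord0 = schur_vec g k n i.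
Proof.
elim: n k i => [|n IH] k i; first by rewrite mxE ord1.
rewrite [Umx _ _ _]/= schur_vecE.
have -> : iota 0 n.+1 = index_iota 0 n.+1 by rewrite /index_iota subn0.
set Q := castmx _ _; rewrite -(big_mkord xpredT
  (fun p => elem_rot n.+2 (g k (k + p.+1)%N) (defect g k (k + p.+1)%N) p)).
have colQ : col ord0 Q = \col_i schur_vec g k.+1 n i.
  apply/colP => j; rewrite !mxE castmxE /=.
  have -> : cast_ord (esym (addn1 n.+1)) ord0 = lshift 1 ord0 :> 'I_(n.+1 + 1).
    exact: val_inj.
  case: (ltnP j n.+1) => jn.
    have -> : cast_ord (esym (addn1 n.+1)) j = lshift 1 (Ordinal jn).
      exact: val_inj.
    by rewrite block_mxEul IH.
  have -> : cast_ord (esym (addn1 n.+1)) j = rshift n.+1 ord0.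
    by apply: val_inj; rewrite /= addn0; apply/eqP; rewrite eqn_leq jn -ltnS ltn_ord.
  by rewrite block_mxEdl mxE schur_vec_supp.
have iota_small : all (fun p => p.+1 < n.+2)%N (index_iota 0 n.+1).
  by apply/allP => p; rewrite mem_index_iota.
move/colP: (givens_seq_col g k (schur_vec g k.+1 n) iota_small) => /(_ i).
by rewrite -colQ colE mulmxA -colE mxE [RHS]mxE.
Qed.

End Contractive.

Lemma gram_det m (T : 'M[C]_m) :
  \det (\matrix_(i, j) \sum_k (T k i)^* * T k j) = `|\det T| ^+ 2.
Proof.
rewrite normCKC -det_map_mx -[\det (_ ^ _)%sesqui]det_tr -det_mulmx.
by congr (\det _); apply/matrixP => i j; rewrite !mxE; apply: eq_bigr => k _; rewrite !mxE.
Qed.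

Section DetFormula.
Variables s g : nat -> nat -> C.
Hypothesis sg : is_parameters s g.
Hypothesis s_herm : forall k j, s j k = (s k j)^*.
Hypothesis s_ge0 : forall k, 0 <= s k k.

Let g1 k j : (k < j)%N -> `|g k j| < 1.
Proof. by case/sg. Qed.

Lemma moment_schur_vec r m (i j : 'I_m) : s (r + i)%N (r + j)%N
  = (sqrtC (s (r + i)%N (r + i)%N))^*
    * pairing m (schur_vec g r i) (schur_vec g r j) * sqrtC (s (r + j)%N (r + j)%N).
Proof.
have sreal k : (sqrtC (s k k))^* = sqrtC (s k k).
  by apply/CrealP/ger0_real; rewrite sqrtC_ge0.
wlog ij : i j / (i <= j)%N => [W|].
  case: (leqP i j) => [|/ltnW] ij; first exact: W.
  have -> : pairing m (schur_vec g r i) (schur_vec g r j) = (pairing m (schur_vec g r j) (schur_vec g r i))^*.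
    rewrite /pairing rmorph_sum; apply: eq_bigr => a _.
    by rewrite rmorphM /= conjCK mulrC.
  rewrite s_herm (W j i ij) sreal !rmorphM /= !sreal.
  ring.
rewrite sreal pairing_schur_vec //.
case: (eqVneq (i : nat) j) => [<-|nij].
  by rewrite subnn mulr1 -expr2 sqrtCK.
have lt_ij : (r + i < r + j)%N by rewrite ltn_add2l ltn_neqAle nij.
have [_ ->] := sg lt_ij; rewrite Umx_schur_vec; congr (_ * schur_vec _ _ _ _ * _); lia.
Qed.

(** The Gram matrix of triangular vectors has the product of the squared
    diagonal entries as determinant ([gram_det]). *)
Lemma Ddet_ratio_parameters r m : Ddet s r.+1 (r + m) != 0 ->
  Ddet s r (r + m) / Ddet s r.+1 (r + m)
    = s r r * \prod_(1 <= j < m.+1) defect g r (r + j)%N ^+ 2.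
Proof.
have Dn r0 m0 q : (q.+1 - r0 = m0)%N -> Ddet s r0 q
    = \prod_(i < m0) (s (r0 + i)%N (r0 + i)%N
        * \prod_(k < i) defect g (r0 + k)%N (r0 + i)%N ^+ 2).
  rewrite /Ddet => ->.
  pose T : 'M[C]_m0 := \matrix_(a, j) schur_vec g r0 j a.
  pose c (i : 'I_m0) := sqrtC (s (r0 + i)%N (r0 + i)%N).
  transitivity (\prod_i (`|c i| ^+ 2 * `|T i i| ^+ 2)).
    transitivity (`|\det (\matrix_(a, j) (T a j * c j))| ^+ 2).
      rewrite -gram_det; congr (\det _); apply/matrixP => i j.
      rewrite !mxE (moment_schur_vec r0 i j) big_distrr big_distrl /=.
      by apply: eq_bigr => k _; rewrite !mxE rmorphM /= /c; ring.
    rewrite -det_tr det_trig; last first.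
      by apply/is_trig_mxP => i j ij; rewrite !mxE schur_vec_supp ?mul0r.
    rewrite normr_prod -prodrXl; apply: eq_bigr => i _.
    by rewrite !mxE normrM exprMn mulrC.
  apply: eq_bigr => i _; rewrite mxE schur_vec_lead; congr (_ * _).
    by rewrite ger0_norm ?sqrtC_ge0 // sqrtCK.
  rewrite normr_prod -prodrXl; apply: eq_bigr => k _.
  by rewrite ger0_norm // ltW // defect_gt0 // ltn_add2l.
have -> : Ddet s r (r + m) = s r r * (\prod_(1 <= j < m.+1) defect g r (r + j)%N ^+ 2)
    * Ddet s r.+1 (r + m).
  rewrite (Dn r m.+1); last by lia.
  rewrite (Dn r.+1 m); last by lia.
  rewrite big_ord_recl addn0 big_ord0 mulr1 -mulrA; congr (_ * _).
  rewrite big_add1 /= big_mkord -big_split /=; apply: eq_bigr => i _.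
  rewrite /bump leq0n add1n big_ord_recl addn0 mulrCA; congr (_ * (_ * _)).
    by congr (s _ _); lia.
  by apply: eq_bigr => k _; congr (defect g _ _ ^+ _); rewrite ?lift0; lia.
by move=> D0; rewrite mulfK.
Qed.

(** The term in X phi_{n-1} of the recursion has no constant term. *)
Lemma ophi_sharp0 n l : (ophi_sharp s g n l).[0]
  = (sqrtC (s l l))^-1 * \prod_(1 <= j < n.+1) (defect g l (l + j)%N)^-1.
Proof.
elim: n => [|n IH]; first by rewrite big_geq // mulr1 /ophi_sharp /= hornerC.
rewrite big_nat_recr //= mulrA -IH /ophi_sharp /=.
by rewrite hornerZ hornerD hornerN hornerZ hornerM hornerX mul0r mulr0 oppr0 add0r mulrC addnC.
Qed.

End DetFormula.
End SchurParameters.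

(** * Complete semi-inner product spaces *)

(** A Hilbert space before the quotient by null vectors: projections exist, and
    are unique up to a null vector. *)
Record semiHilbert (R : realType) (V : lmodType R[i]) := SemiHilbert {
  ipform :> V -> V -> R[i];
  ipDl : forall x y z, ipform (x + y) z = ipform x z + ipform y z;
  ipZl : forall a x z, ipform (a *: x) z = a * ipform x z;
  ipC : forall x y, ipform y x = (ipform x y)^*;
  ip_ge0 : forall x, 0 <= ipform x x;
  ip_complete : forall x : nat -> V,
    (forall eps : R, 0 < eps -> exists N, forall m n, (N <= m)%N -> (N <= n)%N ->
       complex.Re (ipform (x m - x n) (x m - x n)) < eps) ->
    exists l, forall eps : R, 0 < eps -> exists N, forall n, (N <= n)%N ->
       complex.Re (ipform (x n - l) (x n - l)) < eps }.

Section SemiHilbertTheory.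
Context (R : realType) (V : lmodType R[i]) (ip : semiHilbert V).
Local Notation C := R[i].
Implicit Types (x y z e p : V) (a : C) (E : set V) (f : nat -> V) (I : pred nat).

Lemma ipDr x y z : ip x (y + z) = ip x y + ip x z.
Proof. by rewrite ipC ipDl rmorphD /= -!ipC. Qed.
Lemma ipZr a x y : ip x (a *: y) = a^* * ip x y.
Proof. by rewrite ipC ipZl rmorphM /= -!ipC. Qed.
Lemma ip0l y : ip 0 y = 0.
Proof. by rewrite -(scale0r 0) ipZl mul0r. Qed.
Lemma ip0r y : ip y 0 = 0.
Proof. by rewrite ipC ip0l conjC0. Qed.
Lemma ipNl x y : ip (- x) y = - ip x y.
Proof. by rewrite -scaleN1r ipZl mulN1r. Qed.
Lemma ipNr x y : ip x (- y) = - ip x y.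
Proof. by rewrite ipC ipNl rmorphN /= -ipC. Qed.
Lemma ipBl x y z : ip (x - y) z = ip x z - ip y z.
Proof. by rewrite ipDl ipNl. Qed.
Lemma ipBr x y z : ip x (y - z) = ip x y - ip x z.
Proof. by rewrite ipDr ipNr. Qed.
Lemma ip_suml (J : Type) (r : seq J) (P : pred J) (F : J -> V) y :
  ip (\sum_(j <- r | P j) F j) y = \sum_(j <- r | P j) ip (F j) y.
Proof.
by elim/big_ind2: _ => [|u a v b <- <-|//]; rewrite ?ip0l ?ipDl.
Qed.
Lemma ip_sumr (J : Type) (r : seq J) (P : pred J) (F : J -> V) y :
  ip y (\sum_(j <- r | P j) F j) = \sum_(j <- r | P j) ip y (F j).
Proof.
by elim/big_ind2: _ => [|u a v b <- <-|//]; rewrite ?ip0r ?ipDr.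
Qed.

Lemma ip_eq0C x y : ip x y = 0 -> ip y x = 0.
Proof. by move=> h; rewrite ipC h conjC0. Qed.

Lemma conj_real (t : R) : (t%:C%C)^* = t%:C%C :> C.
Proof. exact: conjc_real. Qed.

Definition sqn x : R := complex.Re (ip x x).
Definition sqmod a : R := complex.Re a ^+ 2 + complex.Im a ^+ 2.

Lemma ipE x : ip x x = (sqn x)%:C%C.
Proof. by rewrite /sqn RRe_real // ger0_real // ip_ge0. Qed.
Lemma sqn_ge0 x : 0 <= sqn x.
Proof. by rewrite -ler0c -ipE ip_ge0. Qed.
Lemma sqmodE a : (sqmod a)%:C%C = a * a^*.
Proof. by rewrite -normCK -add_Re2_Im2. Qed.
Lemma sqmod_ge0 a : 0 <= sqmod a.
Proof. by rewrite addr_ge0 // sqr_ge0. Qed.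
Lemma sqmod_eq0 a : sqmod a = 0 -> a = 0.
Proof.
by move=> a0; apply/eqP; rewrite -(mul_conjC_eq0 a) -sqmodE a0.
Qed.
Lemma sqmodD_le a b : sqmod (a + b) <= 2 * sqmod a + 2 * sqmod b.
Proof.
case: a b => [a1 a2] [b1 b2]; rewrite /sqmod /=.
have := sqr_ge0 (a1 - b1); have := sqr_ge0 (a2 - b2); nra.
Qed.
Lemma sqnZ a x : sqn (a *: x) = sqmod a * sqn x.
Proof. by apply: complexI; rewrite -ipE ipZl ipZr rmorphM /= sqmodE -ipE; ring. Qed.
Lemma sqnN x : sqn (- x) = sqn x.
Proof. by apply: complexI; rewrite -!ipE ipNl ipNr opprK. Qed.
Lemma sqn0 : sqn 0 = 0.
Proof. by rewrite /sqn ip0l. Qed.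
Lemma sqnBC x y : sqn (x - y) = sqn (y - x).
Proof. by rewrite -opprB sqnN. Qed.
Lemma sqnD_orth x y : ip x y = 0 -> sqn (x + y) = sqn x + sqn y.
Proof.
move=> xy; apply: complexI; rewrite rmorphD /= -!ipE ipDl !ipDr xy (ip_eq0C xy).
by rewrite addr0 add0r.
Qed.
Lemma parallelogram x y : sqn (x + y) + sqn (x - y) = 2 * sqn x + 2 * sqn y.
Proof.
apply: complexI; rewrite !rmorphD !rmorphM /= rmorph_nat -!ipE.
by rewrite !ipDl !ipDr !ipNl !ipNr; ring.
Qed.
Lemma sqnD_le x y : sqn (x + y) <= 2 * sqn x + 2 * sqn y.
Proof. by rewrite -parallelogram lerDl sqn_ge0. Qed.
Lemma sqnB_le x y z : sqn (x - z) <= 2 * sqn (x - y) + 2 * sqn (y - z).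
Proof. by have := sqnD_le (x - y) (y - z); rewrite addrA subrK. Qed.

(** Moving along y in the direction of <x, y>, with a real step t, turns the
    norm into a real quadratic polynomial in t. *)
Lemma sqn_line x y (t : R) : sqn (x - (t%:C%C * ip x y) *: y)
  = sqn x - 2 * t * sqmod (ip x y) + t ^+ 2 * sqmod (ip x y) * sqn y.
Proof.
apply: complexI.
rewrite expr2 rmorphD rmorphB !rmorphM /= rmorph_nat sqmodE -!ipE.
rewrite ipBl !ipBr !ipZl !ipZr !rmorphM /= [ip y x]ipC conj_real; ring.
Qed.

Lemma cauchy_schwarz x y : sqmod (ip x y) <= sqn x * sqn y.
Proof.
have [y0|y0] := eqVneq (sqn y) 0.
  have [->|n0] := eqVneq (sqmod (ip x y)) 0; first by rewrite mulr_ge0 ?sqn_ge0.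
  have := sqn_ge0 (x - (((sqn x + 1) / sqmod (ip x y))%:C%C * ip x y) *: y).
  rewrite sqn_line y0 mulr0 addr0.
  have -> : 2 * ((sqn x + 1) / sqmod (ip x y)) * sqmod (ip x y) = 2 * (sqn x + 1).
    by rewrite -mulrA divfK.
  have := sqn_ge0 x; lra.
have := sqn_ge0 (x - ((sqn y)^-1%:C%C * ip x y) *: y).
rewrite sqn_line; have y1 : 0 < sqn y by rewrite lt_neqAle eq_sym y0 sqn_ge0.
set N := sqmod _.
have -> : sqn x - 2 * (sqn y)^-1 * N + (sqn y)^-1 ^+ 2 * N * sqn y
   = (sqn x * sqn y - N) / sqn y by field.
by rewrite pmulr_lge0 ?invr_gt0 // subr_ge0.
Qed.

Lemma null_ip x y : sqn x = 0 -> ip x y = 0.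
Proof.
move=> x0; apply: sqmod_eq0; apply/eqP; rewrite eq_le sqmod_ge0 andbT.
by have := cauchy_schwarz x y; rewrite x0 mul0r.
Qed.

Lemma ip_eqv x x' y y' : sqn (x - x') = 0 -> sqn (y - y') = 0 -> ip x y = ip x' y'.
Proof.
move=> hx hy; apply/eqP; rewrite -subr_eq0; apply/eqP.
transitivity (ip (x - x') y + ip x' (y - y')); first by rewrite ipBl ipBr; ring.
by rewrite null_ip // (ip_eq0C (null_ip _ hy)) addr0.
Qed.

Lemma sqn_eqv0 x y : sqn x = 0 -> sqn y = 0 -> sqn (x + y) = 0.
Proof.
move=> x0 y0; apply/eqP; rewrite eq_le sqn_ge0 andbT.
by have := sqnD_le x y; rewrite x0 y0 !mulr0 addr0.
Qed.

Definition subspace E := E 0 /\ forall a x y, E x -> E y -> E (a *: x + y).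
Definition qclosed E :=
  forall x, (forall eps : R, 0 < eps -> exists2 y, E y & sqn (x - y) < eps) -> E x.
Definition is_proj E x p := E p /\ forall e, E e -> ip (x - p) e = 0.
Definition qcvg (x : nat -> V) l := forall eps : R, 0 < eps ->
  exists N, forall n, (N <= n)%N -> sqn (x n - l) < eps.

Lemma subspaceB E x y : subspace E -> E x -> E y -> E (x - y).
Proof. by case=> _ h xE yE; rewrite addrC -scaleN1r; apply: h. Qed.
Lemma subspaceD E x y : subspace E -> E x -> E y -> E (x + y).
Proof. by case=> _ h xE yE; rewrite -[x]scale1r; apply: h. Qed.
Lemma subspaceZ E a x : subspace E -> E x -> E (a *: x).
Proof. by case=> h0 h xE; rewrite -[_ *: x]addr0; apply: h. Qed.

Lemma proj_pythagoras E x p y : subspace E -> is_proj E x p -> E y ->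
  sqn (x - y) = sqn (x - p) + sqn (p - y).
Proof.
move=> sE [pE po] yE; rewrite -sqnD_orth ?addrA ?subrK //.
by apply: po; apply: subspaceB.
Qed.

Lemma proj_uniq E x p p' : subspace E -> is_proj E x p -> is_proj E x p' ->
  sqn (p - p') = 0.
Proof.
move=> sE [pE po] [pE' po']; apply: complexI; rewrite -ipE.
have pp : E (p - p') by exact: subspaceB.
have e : (x - p') - (x - p) = p - p' by rewrite opprB addrC addrA subrK.
by rewrite -{1}e ipBl po' // po // subrr.
Qed.

(** A minimizing sequence is Cauchy by the parallelogram law.  Orthogonality of
    the limit is obtained from the near-minimality of the terms of the sequence. *)
Theorem proj_exists E x : subspace E -> qclosed E -> exists p, is_proj E x p.
Proof.
move=> sE cE.
pose S := [set r | exists2 y, E y & r = sqn (x - y)].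
have infS : has_inf S.
  split; first by exists (sqn (x - 0)), 0 => //; case: sE.
  by exists 0 => r [y _ ->]; exact: sqn_ge0.
pose m := inf S.
have mle y : E y -> m <= sqn (x - y).
  by move=> yE; apply: ge_inf; [case: infS|exists y].
have approx (n : nat) : {y | E y & sqn (x - y) < m + n.+1%:R^-1}.
  apply: cid2; have n0 : 0 < n.+1%:R^-1 :> R by rewrite invr_gt0 ltr0n.
  have [r [y yE ->] ry] := inf_adherent n0 infS.
  by exists y.
pose y n := s2val (approx n).
have yE n : E (y n) by exact: (s2valP (approx n)).
have yl n : sqn (x - y n) < m + n.+1%:R^-1 by exact: (s2valP' (approx n)).
have small (eps : R) : 0 < eps -> exists N : nat, forall n, (N <= n)%N -> n.+1%:R^-1 < eps.
  move=> e0; exists (Num.truncn eps^-1) => n Nn; rewrite invf_plt ?posrE ?ltr0n //.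
  apply: lt_le_trans (truncnS_gt _) _; by rewrite ler_nat ltnS.
have [l ly] : exists l, qcvg y l.
  apply: ip_complete => eps e0; have [N hN] := small (eps / 4) (divr_gt0 e0 (ltr0n _ 4)).
  exists N => i j Ni Nj; rewrite -/(sqn _).
  have li : sqn (x - y i) < m + eps / 4.
    by apply: lt_trans (yl i) _; rewrite ltrD2l hN.
  have lj : sqn (x - y j) < m + eps / 4.
    by apply: lt_trans (yl j) _; rewrite ltrD2l hN.
  have mid : E (2^-1 *: (y i + y j)) by apply: subspaceZ => //; apply: subspaceD.
  have := mle _ mid.
  have := parallelogram (x - y i) (x - y j).
  have -> : x - y i + (x - y j) = (2 : C) *: (x - 2^-1 *: (y i + y j)).
    rewrite scalerBr scalerA divff ?pnatr_eq0 // scale1r scaler_nat.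
    by rewrite mulr2n opprD addrACA.
  have -> : x - y i - (x - y j) = y j - y i by rewrite opprB addrC addrA subrK.
  have n4 : sqmod 2 = 4
    by apply: complexI; rewrite sqmodE conjC_nat -natrM rmorph_nat.
  rewrite sqnZ n4 [sqn (y j - y i)]sqnBC; lra.
have lE : E l.
  by apply: cE => eps e0; have [N /(_ N (leqnn N))] := ly _ e0; rewrite sqnBC; exists (y N).
exists l; split => // e eE; apply: sqmod_eq0; apply/eqP; rewrite eq_le sqmod_ge0 andbT.
have q0 := sqn_ge0 e; set q := sqn e in q0 *; have q1 : 0 < q + 1 by lra.
have orth_small n : sqmod (ip (x - y n) e) <= (q + 1) * n.+1%:R^-1.
  have := sqn_line (x - y n) e (q + 1)^-1; rewrite -/q; set N := sqmod _; set z := _ *: e.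
  have N0 : 0 <= N := sqmod_ge0 _.
  have zE : E (y n + z) by apply: subspaceD => //; apply: subspaceZ.
  have := mle _ zE; rewrite opprD addrA => hm eq; rewrite eq in hm; have := yl n.
  have -> : N = (q + 1) * (N / (q + 1)) by rewrite mulrC divfK // gt_eqF.
  move=> hy; rewrite ler_pM2l //; apply: le_trans (_ : N * (q + 2) / (q + 1) ^+ 2 <= _).
    rewrite expr2 invfM mulrA ler_pM2r ?invr_gt0 // ler_pdivlMr //.
    by apply: ler_wpM2l => //; rewrite lerD2l ler1n.
  have -> : N * (q + 2) / (q + 1) ^+ 2 = 2 * (q + 1)^-1 * N - (q + 1)^-1 ^+ 2 * N * q.
    by field; lra.
  by move: hm hy; move: (n.+1%:R^-1) => b hm hy; lra.
apply/ler_addgt0Pr => eps e0; rewrite add0r.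
have d0 : 0 < eps / (8 * (q + 1)) by apply: divr_gt0 => //; lra.
have [N1 h1] := small _ d0; have [N2 h2] := ly _ d0.
pose n := maxn N1 N2.
have {}h1 := h1 n (leq_maxl _ _); have {}h2 := h2 n (leq_maxr _ _).
have h3 := orth_small n; have h4 := cauchy_schwarz (y n - l) e.
have -> : ip (x - l) e = ip (x - y n) e + ip (y n - l) e.
  by rewrite -ipDl addrA subrK.
apply: le_trans (sqmodD_le _ _) _.
rewrite -/q in h4.
have h5 : (q + 1) / n.+1%:R <= eps / 8.
  apply: (@le_trans _ _ ((q + 1) * (eps / (8 * (q + 1))))); first by apply: ler_wpM2l; exact: ltW.
  by rewrite le_eqVlt; apply/orP; left; apply/eqP; field; lra.
have h6 : sqn (y n - l) * q <= eps / 8.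
  apply: (@le_trans _ _ ((eps / (8 * (q + 1))) * (q + 1))).
    by apply: ler_pM => //; [exact: sqn_ge0|exact: ltW|lra].
  by rewrite le_eqVlt; apply/orP; left; apply/eqP; field; lra.
by move: h3 h5 h6 h4 e0; move: ((q + 1) / n.+1%:R) (sqn (y n - l) * q) (sqmod _) (sqmod _) => *; lra.
Qed.

Definition prj E x := xget 0 [set p | is_proj E x p].

Lemma prjP E x : subspace E -> qclosed E -> is_proj E x (prj E x).
Proof.
by move=> sE cE; have [p pP] := proj_exists x sE cE; rewrite /prj; case: xgetP => [y _ //|/(_ p)].
Qed.

Definition cspan f I : set V := [set x | forall eps : R, 0 < eps ->
  exists n (c : nat -> C), sqn (x - \sum_(k < n | I k) c k *: f k) < eps].

Lemma comb_widen f I n N (c : nat -> C) : (n <= N)%N ->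
  \sum_(k < n | I k) c k *: f k = \sum_(k < N | I k) (if (k < n)%N then c k else 0) *: f k.
Proof.
move=> nN; rewrite (big_ord_widen_cond N I (fun k => c k *: f k) nN) big_mkcondr /=.
by apply: eq_bigr => k _; case: ifP; rewrite ?scale0r.
Qed.

Lemma comb_lin f I n1 n2 (c1 c2 : nat -> C) a : exists n (c : nat -> C),
  a *: (\sum_(k < n1 | I k) c1 k *: f k) + \sum_(k < n2 | I k) c2 k *: f k
  = \sum_(k < n | I k) c k *: f k.
Proof.
exists (maxn n1 n2).
exists (fun k => a * (if (k < n1)%N then c1 k else 0) + (if (k < n2)%N then c2 k else 0)).
rewrite (comb_widen f I c1 (leq_maxl n1 n2)) (comb_widen f I c2 (leq_maxr n1 n2)).
rewrite scaler_sumr -big_split /=; apply: eq_bigr => k _.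
by rewrite scalerDl scalerA.
Qed.

Lemma cspan_comb f I n (c : nat -> C) : cspan f I (\sum_(k < n | I k) c k *: f k).
Proof. by move=> eps e0; exists n, c; rewrite subrr sqn0. Qed.

Lemma cspan_subspace f I : subspace (cspan f I).
Proof.
split=> [eps e0|a x y hx hy eps e0].
  by exists 0%N, (fun=> 0); rewrite big_ord0 subrr sqn0.
have a1 : 0 < 4 * (sqmod a + 1) by have := sqmod_ge0 a; lra.
have [n1 [c1 h1]] := hx _ (divr_gt0 e0 a1).
have [n2 [c2 h2]] := hy _ (divr_gt0 e0 (ltr0n _ 4)).
have [n [c hc]] := comb_lin f I n1 n2 c1 c2 a; exists n, c; rewrite -hc.
rewrite opprD addrACA -scalerBr; apply: le_lt_trans (sqnD_le _ _) _; rewrite sqnZ.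
have h3 : sqmod a * sqn (x - \sum_(k < n1 | I k) c1 k *: f k) <= eps / 4.
  apply: (@le_trans _ _ ((sqmod a + 1) * (eps / (4 * (sqmod a + 1))))).
    by apply: ler_pM; [exact: sqmod_ge0|exact: sqn_ge0|lra|exact: ltW].
  by rewrite le_eqVlt; apply/orP; left; apply/eqP; field; have := sqmod_ge0 a; lra.
lra.
Qed.

Lemma cspan_closed f I : qclosed (cspan f I).
Proof.
move=> x h eps e0; have e4 : 0 < eps / 4 by lra.
have [y hy xy] := h _ e4; have [n [c hc]] := hy _ e4; exists n, c.
by apply: le_lt_trans (sqnB_le _ y _) _; lra.
Qed.

Lemma cspan_mem f I k : I k -> cspan f I (f k).
Proof.
move=> Ik; have := @cspan_comb f I k.+1 (fun i => (i == k)%:R).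
have -> : \sum_(i < k.+1 | I i) ((i : nat) == k)%:R *: f i = f k.
  rewrite (bigD1 ord_max) //= eqxx scale1r big1 ?addr0 // => i /andP[_ ik].
  have /negbTE -> : (i : nat) != k by apply: contra ik => /eqP h; apply/eqP/val_inj.
  by rewrite scale0r.
by [].
Qed.

Lemma sub_cspan f I E : subspace E -> qclosed E -> (forall k, I k -> E (f k)) ->
  cspan f I `<=` E.
Proof.
move=> sE cE h x hx; apply: cE => eps e0; have [n [c hc]] := hx _ e0.
exists (\sum_(k < n | I k) c k *: f k) => //.
elim/big_ind: _ => [|u v|k Ik]; [by case: sE|exact: subspaceD|].
by apply: subspaceZ => //; exact: h.
Qed.

Lemma cspan_mono f I (J : pred nat) : (forall k, I k -> J k) -> cspan f I `<=` cspan f J.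
Proof.
move=> IJ; apply: sub_cspan; [exact: cspan_subspace|exact: cspan_closed|].
by move=> k /IJ; exact: cspan_mem.
Qed.

Lemma orth_subspace z : subspace [set y | ip z y = 0].
Proof.
split=> [|a x y /= hx hy]; rewrite /= ?ip0r //.
by rewrite ipDr ipZr hx hy mulr0 addr0.
Qed.

Lemma orth_closed z : qclosed [set y | ip z y = 0].
Proof.
move=> x h /=; apply: sqmod_eq0; apply/eqP; rewrite eq_le sqmod_ge0 andbT.
apply/ler_addgt0Pr => eps e0; rewrite add0r.
have q1 : 0 < sqn z + 1 by have := sqn_ge0 z; lra.
have [y /= zy hy] := h _ (divr_gt0 e0 q1).
have -> : ip z x = ip z (x - y) by rewrite ipBr zy subr0.
apply: le_trans (cauchy_schwarz _ _) _.
apply: (@le_trans _ _ ((sqn z + 1) * (eps / (sqn z + 1)))); last by rewrite mulrC divfK ?gt_eqF.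
by apply: ler_pM; [exact: sqn_ge0|exact: sqn_ge0|lra|exact: ltW].
Qed.

Lemma cspan_orth f I z : (forall k, I k -> ip z (f k) = 0) ->
  forall y, cspan f I y -> ip z y = 0.
Proof. by move=> h; apply: sub_cspan (@orth_closed z) _; [exact: orth_subspace|]. Qed.

Lemma is_projZ E a x p : subspace E -> is_proj E x p -> is_proj E (a *: x) (a *: p).
Proof.
move=> sE [pE po]; split; first exact: subspaceZ.
by move=> e eE; rewrite -scalerBr ipZl po // mulr0.
Qed.

Lemma is_projD E x p y q : subspace E -> is_proj E x p -> is_proj E y q ->
  is_proj E (x + y) (p + q).
Proof.
move=> sE [pE po] [qE qo]; split; first exact: subspaceD.
by move=> e eE; rewrite opprD addrACA ipDl po // qo // addr0.
Qed.

Lemma is_proj0 E : subspace E -> is_proj E 0 0.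
Proof. by case=> E0 _; split => // e _; rewrite subrr ip0l. Qed.

Lemma is_projB E x p y q : subspace E -> is_proj E x p -> is_proj E y q ->
  is_proj E (x - y) (p - q).
Proof.
by move=> sE hx hy; rewrite -(scaleN1r y) -(scaleN1r q); apply: is_projD => //; exact: is_projZ.
Qed.

Lemma is_proj_sum E n (a : 'I_n -> C) (x p : 'I_n -> V) : subspace E ->
  (forall l, is_proj E (x l) (p l)) ->
  is_proj E (\sum_l a l *: x l) (\sum_l a l *: p l).
Proof.
move=> sE h; elim/big_ind2: _ => [|u q v w|l _]; [exact: is_proj0|exact: is_projD|].
exact: is_projZ.
Qed.

Lemma is_proj_sym E x p y q : is_proj E x p -> is_proj E y q -> ip p y = ip x q.
Proof.
move=> [pE po] [qE qo]; transitivity (ip p q).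
  by apply/eqP; rewrite -subr_eq0 -ipBr (ip_eq0C (qo _ pE)).
by apply/esym/eqP; rewrite -subr_eq0 -ipBl po.
Qed.

Lemma is_proj_resid_le E x p : subspace E -> is_proj E x p -> sqn (x - p) <= sqn x.
Proof.
move=> sE hp; have := proj_pythagoras sE hp (y := 0); rewrite !subr0 => ->; last by case: sE.
by rewrite lerDl sqn_ge0.
Qed.

Lemma is_proj_le E x p : subspace E -> is_proj E x p -> sqn p <= sqn x.
Proof.
move=> sE hp; have := proj_pythagoras sE hp (y := 0); rewrite !subr0 => ->; last by case: sE.
by rewrite lerDr sqn_ge0.
Qed.

Lemma prj_cspan f I x : is_proj (cspan f I) x (prj (cspan f I) x).
Proof. apply: prjP; [exact: cspan_subspace|exact: cspan_closed]. Qed.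

Section Innovations.
Context (f : nat -> V).
Implicit Types (Q : pred nat) (l r m : nat).

Definition tail Q l := cspan f [pred k | (l <= k)%N && Q k].
Definition innov Q l := f l - prj (tail Q l.+1) (f l).

Lemma tail_mono Q l l' x : (l <= l')%N -> tail Q l' x -> tail Q l x.
Proof.
by move=> ll; apply: cspan_mono => k /= /andP[lk ->]; rewrite (leq_trans ll lk).
Qed.

Lemma tail_subspace Q l : subspace (tail Q l).
Proof. exact: cspan_subspace. Qed.

Lemma prj_tail Q l x : is_proj (tail Q l) x (prj (tail Q l) x).
Proof. exact: prj_cspan. Qed.

Lemma innov_orth Q l y : tail Q l.+1 y -> ip (innov Q l) y = 0.
Proof. by have [_] := prj_tail Q l.+1 (f l); apply. Qed.

Lemma tail_mem Q l k : (l <= k)%N -> Q k -> tail Q l (f k).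
Proof. by move=> lk Qk; apply: cspan_mem; rewrite /= lk Qk. Qed.

Lemma innov_in Q l : Q l -> tail Q l (innov Q l).
Proof.
move=> Ql; apply: (@subspaceB (tail Q l)); [exact: cspan_subspace|exact: tail_mem|].
by apply: (tail_mono (leqnSn l)); case: (prj_tail Q l.+1 (f l)).
Qed.

Lemma innov_orthogonal Q l l' : Q l -> Q l' -> l != l' ->
  ip (innov Q l) (innov Q l') = 0.
Proof.
move=> Ql Ql'; rewrite neq_ltn => /orP[] ll; last apply: ip_eq0C.
  by apply: innov_orth; apply: (tail_mono ll); exact: innov_in.
by apply: innov_orth; apply: (tail_mono ll); exact: innov_in.
Qed.

Definition icoef Q z l : C := ip z (innov Q l) / (sqn (innov Q l))%:C%C.

(** The difference of the two sides is in the span from r on and is orthogonal to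
    the tail from r+m on and to the innovations, hence, by descending induction,
    to every f_l with l >= r: it is a null vector. *)
Lemma innov_expansion Q r m z p :
  (forall l, (r <= l < r + m)%N -> Q l) ->
  (forall l, (r <= l < r + m)%N -> sqn (innov Q l) != 0) ->
  tail Q r z -> is_proj (tail Q (r + m)) z p ->
  sqn (z - p - \sum_(l < m) icoef Q z (r + l) *: innov Q (r + l)) = 0.
Proof.
move=> hQ hw zr [pT po]; set S := \sum_(_ < m) _; pose y := z - p - S.
have rng (l : 'I_m) : (r <= r + l < r + m)%N by rewrite leq_addr ltn_add2l /=.
have sub := tail_subspace Q r.
have yr : tail Q r y.
  rewrite /y; apply: (subspaceB sub).
    by apply: (subspaceB sub) => //; exact: (tail_mono (leq_addr m r)).
  rewrite /S; elim/big_ind: _ => [|u v|l _]; [by case: sub|exact: (subspaceD sub)|].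
  apply: (subspaceZ _ sub); apply: (tail_mono (leq_addr l r)).
  by apply: innov_in; apply: hQ.
have yT e : tail Q (r + m) e -> ip y e = 0.
  move=> eT; rewrite /y ipBl po // /S ip_suml big1 ?subr0 // => l _.
  rewrite ipZl innov_orth ?mulr0 //; apply: (tail_mono _ eT).
  by rewrite ltn_add2l.
have yw l : (r <= l < r + m)%N -> ip y (innov Q l) = 0.
  move=> lrm; have lm : (l - r < m)%N by lia.
  have pw : ip p (innov Q l) = 0.
    apply: ip_eq0C; apply: innov_orth; apply: (tail_mono _ pT); by case/andP: lrm.
  rewrite /y !ipBl pw subr0 /S ip_suml (bigD1 (Ordinal lm)) //=.
  rewrite subnKC; last by case/andP: lrm.
  rewrite big1 ?addr0 => [|i ni].
    by rewrite ipZl ipE /icoef divfK ?subrr // (inj_eq (@complexI _) _ 0) hw.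
  rewrite ipZl innov_orthogonal ?mulr0 //; try exact: hQ.
  by apply: contra ni => /eqP e; rewrite -val_eqE /=; apply/eqP; lia.
have yall j : (j <= m)%N -> forall e, tail Q (r + m - j) e -> ip y e = 0.
  elim: j => [|j IH] jm; first by rewrite subn0.
  set l := (r + m - j.+1)%N; have lS : (r + m - j)%N = l.+1 by rewrite /l; lia.
  apply: cspan_orth => k /= /andP[]; rewrite leq_eqVlt => /orP[/eqP <- _|lk Qk].
    have -> : f l = innov Q l + prj (tail Q l.+1) (f l) by rewrite subrK.
    rewrite ipDr yw; last by rewrite /l; lia.
    by rewrite add0r; apply: IH; [exact: ltnW|rewrite lS; case: (prj_tail Q l.+1 (f l))].
  by apply: IH; [exact: ltnW|rewrite lS; exact: tail_mem].
apply: complexI; rewrite -ipE -/y; apply: (yall m (leqnn m)).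
by rewrite addnK.
Qed.

Lemma ip_expansion n (v : 'I_n -> V) (a b : 'I_n -> C) x y :
  sqn (x - \sum_l a l *: v l) = 0 -> sqn (y - \sum_l b l *: v l) = 0 ->
  ip x y = \sum_l \sum_k a l * (b k)^* * ip (v l) (v k).
Proof.
move=> hx hy; rewrite (ip_eqv hx hy) ip_suml; apply: eq_bigr => l _.
by rewrite ip_sumr; apply: eq_bigr => k _; rewrite ipZl ipZr mulrA.
Qed.

Lemma gram_change n (v : 'I_n -> V) (t : 'M[C]_n) (x : 'I_n -> V) :
  (forall j, sqn (x j - \sum_l t l j *: v l) = 0) ->
  \det (\matrix_(i, j) ip (x j) (x i)) = `|\det t| ^+ 2 * \det (\matrix_(i, j) ip (v j) (v i)).
Proof.
move=> h; rewrite normCKC -det_map_mx -[\det (_ ^ _)%sesqui]det_tr mulrAC -!det_mulmx.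
congr (\det _); apply/matrixP => i j; rewrite !mxE (ip_expansion (h j) (h i)).
apply: eq_bigr => l _; rewrite !mxE mulr_suml; apply: eq_bigr => k _.
by rewrite !mxE; ring.
Qed.

(** By [innov_expansion] the residues are a unitriangular combination of the
    innovations, which are orthogonal. *)
Lemma gram_innov Q r m (p : 'I_m -> V) :
  (forall l, (r <= l < r + m)%N -> Q l) ->
  (forall l, (r <= l < r + m)%N -> sqn (innov Q l) != 0) ->
  (forall j : 'I_m, is_proj (tail Q (r + m)) (f (r + j)%N) (p j)) ->
  \det (\matrix_(i, j < m) ip (f (r + j)%N - p j) (f (r + i)%N - p i))
  = (\prod_(l < m) sqn (innov Q (r + l)%N))%:C%C.
Proof.
move=> hQ hw hp.
have rng (l : 'I_m) : (r <= r + l < r + m)%N by rewrite leq_addr ltn_add2l /=.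
pose t : 'M[C]_m := \matrix_(l, j) icoef Q (f (r + j)%N) (r + l)%N.
rewrite (gram_change (v := fun l : 'I_m => innov Q (r + l)) (t := t)) => [|j]; last first.
  under eq_bigr => l _ do rewrite mxE.
  apply: innov_expansion => //; apply: tail_mem (leq_addr _ _) _; exact: hQ.
have -> : \det t = 1.
  rewrite det_trig; last first.
    apply/is_trig_mxP => l j lj; rewrite mxE /icoef ip_eq0C ?mul0r //.
    by apply: innov_orth; apply: tail_mem; [rewrite ltn_add2l|exact: hQ].
  apply: big1 => l _; rewrite mxE /icoef.
  have [pT _] := prj_tail Q (r + l).+1 (f (r + l)).
  have e : f (r + l) = innov Q (r + l) + prj (tail Q (r + l).+1) (f (r + l)) by rewrite subrK.
  rewrite {1}e ipDl (ip_eq0C (innov_orth pT)) addr0 ipE divff //.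
  by rewrite (inj_eq (@complexI _) _ 0) hw.
rewrite normr1 expr1n mul1r det_trig; last first.
  apply/is_trig_mxP => i j ij; rewrite mxE innov_orthogonal //; try exact: hQ.
  by rewrite eqn_add2l gt_eqF.
by rewrite rmorph_prod /=; apply: eq_bigr => l _; rewrite mxE ipE.
Qed.

End Innovations.

Lemma sylvester_det m n (P : 'M[C]_(m, n)) (X : 'M[C]_(n, m)) :
  \det (1%:M + P *m X) = \det (1%:M + X *m P).
Proof.
pose M : 'M[C]_(m + n) := block_mx 1%:M (- P) X 1%:M.
transitivity (\det M).
  have -> : M = block_mx (1%:M + P *m X) (- P) 0 1%:M *m block_mx 1%:M 0 X 1%:M.
    rewrite mulmx_block !mulmx1 !mulmx0 ?mul0mx !mul1mx !add0r mulNmx addrK.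
    by [].
  by rewrite det_mulmx det_ublock det_lblock !det1 !mulr1.
have -> : M = block_mx 1%:M 0 X 1%:M *m block_mx 1%:M (- P) 0 (1%:M + X *m P).
  rewrite mulmx_block !mulmx1 !mulmx0 ?mul0mx !mul1mx !addr0 mulmxN addrC addrK.
  by [].
by rewrite det_mulmx det_ublock det_lblock !det1 !mul1r.
Qed.

(** The abstract counterpart of [has_det]. *)
Definition det_repr (A : V -> V) (z : C) := exists n (e : 'I_n -> V),
  [/\ forall i j, ip (e i) (e j) = (i == j)%:R,
      forall g, sqn (A g - g - \sum_i ip (A g - g) (e i) *: e i) = 0 &
      z = \det (\matrix_(i, j) ip (A (e j)) (e i))].

(** With B = A - I and P the matrix of one basis in the other, the two matrices
    are 1 + P X and 1 + X P; symmetry of B is used to see that B does not feel the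
    projection on the span of the first basis. *)
Lemma det_repr_uniq (A : V -> V) (z z' : C) :
  (forall x y, ip (A x - x) y = ip x (A y - y)) ->
  det_repr A z -> det_repr A z' -> z = z'.
Proof.
move=> sym [n [e [eo eB ->]]] [n' [e' [eo' eB' ->]]].
pose B x := A x - x; have AE x : A x = x + B x by rewrite addrC subrK.
have ipB x y m (v : 'I_m -> V) : (forall g, sqn (B g - \sum_i ip (B g) (v i) *: v i) = 0) ->
    ip (B x) y = \sum_k ip (v k) y * ip (B x) (v k).
  move=> h; have q0 : sqn (y - y) = 0 by rewrite subrr sqn0.
  rewrite (ip_eqv (h x) q0) ip_suml.
  by apply: eq_bigr => k _; rewrite ipZl mulrC.
pose P : 'M[C]_(n, n') := \matrix_(i, k) ip (e' k) (e i).
pose X : 'M[C]_(n', n) := \matrix_(k, j) ip (B (e j)) (e' k).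
have -> : \matrix_(i, j) ip (A (e j)) (e i) = 1%:M + P *m X.
  apply/matrixP => i j; rewrite !mxE AE ipDl eo eq_sym; congr (_ + _).
  by rewrite (ipB _ _ _ _ eB'); apply: eq_bigr => k _; rewrite !mxE.
have -> : \matrix_(i, j) ip (A (e' j)) (e' i) = 1%:M + X *m P.
  apply/matrixP => i j; rewrite !mxE AE ipDl eo' eq_sym; congr (_ + _).
  rewrite sym ipC (ipB _ _ _ _ eB) rmorph_sum; apply: eq_bigr => k _.
  by rewrite !mxE rmorphM /= -!ipC [in LHS]mulrC -sym.
exact: sylvester_det.
Qed.

(** In the orthonormal basis e of normalized innovations of the finite family,
    the matrix is the Gram matrix of the e_i - P2 e_i.  Passing from e to the f_l
    multiplies Gram determinants by |det t|^2, and this factor is itself the Gram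
    determinant of the f_l. *)
Theorem det_sandwich_innov f (Q : pred nat) r m (P1 P2 : V -> V) (z : C) :
  let Qf : pred nat := [pred k | (k < r + m)%N] in
  (forall l, (r <= l < r + m)%N -> Q l) ->
  (forall l, (r <= l < r + m)%N -> sqn (innov f Q l) != 0) ->
  (forall l, (r <= l < r + m)%N -> sqn (innov f Qf l) != 0) ->
  (forall x, is_proj (tail f Qf r) x (P1 x)) ->
  (forall x, is_proj (tail f Q (r + m)) x (P2 x)) ->
  det_repr (fun x => x - P1 (P2 (P1 x))) z <->
  z = (\prod_(l < m) sqn (innov f Q (r + l)) / \prod_(l < m) sqn (innov f Qf (r + l)))%:C%C.
Proof.
move=> Qf hQ hw hwf hP1 hP2; set A := fun x => _.
have hQf l : (r <= l < r + m)%N -> Qf l by case/andP.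
have rng (l : 'I_m) : (r <= r + l < r + m)%N by rewrite leq_addr ltn_add2l /=.
have sE1 : subspace (tail f Qf r) by exact: tail_subspace.
have sE2 : subspace (tail f Q (r + m)) by exact: tail_subspace.
have BE x : A x - x = - P1 (P2 (P1 x)) by rewrite /A addrC addKr.
have sym x y : ip (A x - x) y = ip x (A y - y).
  rewrite !BE ipNl ipNr; congr (- _).
  by rewrite (is_proj_sym (hP1 _) (hP1 y)) (is_proj_sym (hP2 _) (hP2 _)) (is_proj_sym (hP1 _) (hP1 _)).
pose w l := innov f Qf l.
pose c l : C := (Num.sqrt (sqn (w l)))^-1%:C%C.
have cc (l : 'I_m) : c (r + l)%N * c (r + l)%N = (sqn (w (r + l)%N))%:C%C^-1.
  rewrite -rmorphM /= -invfM -expr2 sqr_sqrtr ?sqn_ge0 //.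
  by rewrite -[LHS]mulr1 -[in RHS]rmorphV /= ?mulr1 // unitfE hwf.
pose e (l : 'I_m) := c (r + l)%N *: w (r + l)%N.
have eo i j : ip (e i) (e j) = (i == j)%:R.
  rewrite ipZl ipZr conj_real mulrA; have [->|ij] := eqVneq i j.
    by rewrite cc ipE mulVf // (inj_eq (@complexI _) _ 0) hwf.
  rewrite innov_orthogonal ?mulr0 //; try exact: hQf.
  by rewrite eqn_add2l.
have eP x : tail f Qf r x -> sqn (x - \sum_l ip x (e l) *: e l) = 0.
  move=> xE; have p0 : is_proj (tail f Qf (r + m)) x 0.
    split; first by case: (tail_subspace f Qf (r + m)).
    by apply: cspan_orth => k /andP[/= mk]; rewrite /Qf /= ltnNge mk.
  rewrite -(innov_expansion hQf hwf xE p0) subr0; congr (sqn (_ - _)).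
  apply: eq_bigr => l _; rewrite /e ipZr conj_real scalerA mulrAC.
  by rewrite [c _ * c _]cc /icoef mulrC.
have eB x : sqn (A x - x - \sum_i ip (A x - x) (e i) *: e i) = 0.
  by apply: eP; rewrite BE -scaleN1r; apply: (subspaceZ _ sE1); case: (hP1 (P2 (P1 x))).
have eE1 l : tail f Qf r (e l).
  apply: (subspaceZ _ sE1); apply: (tail_mono (leq_addr l r)); apply: innov_in; exact: hQf.
have repr : det_repr A (\det (\matrix_(i, j) ip (A (e j)) (e i))) by exists m, e.
suff -> : (\prod_(l < m) sqn (innov f Q (r + l)) / \prod_(l < m) sqn (innov f Qf (r + l)))%:C%C
    = \det (\matrix_(i, j) ip (A (e j)) (e i)).
  by split=> [h|->//]; exact: (det_repr_uniq sym h repr).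
have -> : \matrix_(i, j) ip (A (e j)) (e i) = \matrix_(i, j) ip (e j - P2 (e j)) (e i - P2 (e i)).
  apply/matrixP => i j; rewrite !mxE /A ipBl (is_proj_sym (hP1 _) (hP1 (e i))).
  have P1e : sqn (P1 (e i) - e i) = 0.
    by apply: (@proj_uniq _ (e i)) (hP1 _) _ => //; split => // y _; rewrite subrr ip0l.
  have P1e' : sqn (P1 (e j) - e j) = 0.
    by apply: (@proj_uniq _ (e j)) (hP1 _) _ => //; split => // y _; rewrite subrr ip0l.
  have P2e : sqn (P2 (P1 (e j)) - P2 (e j)) = 0.
    apply/eqP; rewrite eq_le sqn_ge0 andbT -P1e'.
    by apply: (is_proj_le sE2); exact: is_projB.
  rewrite (ip_eqv P2e P1e) ipBr.
  have [P2E _] := hP2 (e i); have [_ po] := hP2 (e j); rewrite (po _ P2E) subr0.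
  by rewrite ipBl.
pose t : 'M[C]_m := \matrix_(l, j) ip (f (r + j)%N) (e l).
have fE (j : 'I_m) : sqn (f (r + j)%N - \sum_l t l j *: e l) = 0.
  under eq_bigr => l _ do rewrite mxE.
  by apply: eP; apply: tail_mem (leq_addr _ _) _; exact: hQf.
have fE2 (j : 'I_m) : sqn (f (r + j)%N - P2 (f (r + j)%N) - \sum_l t l j *: (e l - P2 (e l))) = 0.
  under eq_bigr => l _ do rewrite scalerBr.
  rewrite big_split /= sumrN opprD addrACA -opprD.
  have pf := is_projB sE2 (hP2 (f (r + j)%N)) (is_proj_sum (fun l => t l j) sE2 (fun l => hP2 (e l))).
  apply/eqP; rewrite eq_le sqn_ge0 andbT -[X in _ <= X](fE j).
  exact: (is_proj_resid_le sE2 pf).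
have G1 := gram_innov hQ hw (fun j : 'I_m => hP2 (f (r + j)%N)).
rewrite (gram_change fE2) in G1.
have G2 : `|\det t| ^+ 2 = (\prod_(l < m) sqn (innov f Qf (r + l)))%:C%C.
  have p0 x : is_proj (tail f Qf (r + m)) x 0.
    split; first by case: (tail_subspace f Qf (r + m)).
    by apply: cspan_orth => k /andP[/= mk]; rewrite /Qf /= ltnNge mk.
  rewrite -(gram_innov hQf hwf (fun j : 'I_m => p0 (f (r + j)%N))).
  have -> : \matrix_(i, j < m) ip (f (r + j)%N - 0) (f (r + i)%N - 0)
    = \matrix_(i, j < m) ip (f (r + j)%N) (f (r + i)%N).
    by apply/matrixP => i j; rewrite !mxE !subr0.
  rewrite (gram_change fE).
  have -> : \matrix_(i, j) ip (e j) (e i) = 1%:M :> 'M[C]_m.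
    by apply/matrixP => i j; rewrite !mxE eo eq_sym.
  by rewrite det1 mulr1.
rewrite rmorphM rmorphV /=; last first.
  by rewrite unitfE; apply/prodf_neq0 => l _; exact: hwf.
rewrite -G1 -G2 mulrAC divff ?mul1r // G2 (inj_eq (@complexI _) _ 0).
by apply/prodf_neq0 => l _; exact: hwf.
Qed.

Lemma qcvg_le (x y z : nat -> V) (l a b : V) : qcvg y a -> qcvg z b ->
  (forall n, sqn (x n - l) <= 2 * sqn (y n - a) + 2 * sqn (z n - b)) -> qcvg x l.
Proof.
move=> hy hz h eps e0; have e4 : 0 < eps / 4 by lra.
have [N1 h1] := hy _ e4; have [N2 h2] := hz _ e4.
exists (maxn N1 N2) => n; rewrite geq_max => /andP[/h1 {}h1 /h2 {}h2].
by apply: le_lt_trans (h n) _; lra.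
Qed.

Lemma qcvg_null (x : nat -> V) l : (forall n, sqn (x n - l) = 0) -> qcvg x l.
Proof. by move=> h eps e0; exists 0%N => n _; rewrite h. Qed.

Lemma qcvg_proj_increasing (E : nat -> set V) x (p : nat -> V) :
  (forall n, subspace (E n)) -> (forall n, is_proj (E n) x (p n)) ->
  (forall eps : R, 0 < eps -> exists N, forall n, (N <= n)%N ->
     exists2 y, E n y & sqn (x - y) < eps) -> qcvg p x.
Proof.
move=> sE hp h eps e0; have [N hN] := h _ e0; exists N => n /hN[y yE hy].
rewrite sqnBC; apply: le_lt_trans hy.
by rewrite (proj_pythagoras (sE n) (hp n) yE) lerDl sqn_ge0.
Qed.

Lemma decreasing_cauchy (u : nat -> R) : (forall m n, (m <= n)%N -> u n <= u m) ->
  (forall n, 0 <= u n) -> forall eps : R, 0 < eps -> exists N, forall m n,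
  (N <= m)%N -> (m <= n)%N -> u m - u n < eps.
Proof.
move=> dec pos eps e0.
have infu : has_inf (range u).
  by split; [exists (u 0%N), 0%N|exists 0 => _ [n _ <-]].
have [_ [N _ <-] hN] := inf_adherent e0 infu.
exists N => m n Nm mn; have h1 := dec _ _ Nm.
have h2 : inf (range u) <= u n by apply: ge_inf; [case: infu|exists n].
lra.
Qed.

(** The squared norms of the projections decrease, and by Pythagoras their
    differences are the squared distances of the projections. *)
Theorem qcvg_proj_decreasing (E : nat -> set V) x (p : nat -> V) q :
  (forall n, subspace (E n)) -> (forall n, qclosed (E n)) ->
  (forall m n, (m <= n)%N -> E n `<=` E m) ->
  (forall n, is_proj (E n) x (p n)) -> is_proj (\bigcap_n E n) x q -> qcvg p q.
Proof.
move=> sE cE dec hp hq.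
have pyth m n : (m <= n)%N -> sqn (p m - p n) = sqn (p m) - sqn (p n).
  move=> mn; have pmn : is_proj (E n) (p m) (p n).
    split; first by case: (hp n).
    move=> e eE; have -> : p m - p n = (x - p n) - (x - p m).
      by rewrite opprB [RHS]addrC addrA subrK.
    rewrite ipBl; have [_ -> //] := hp n; have [_ -> ] := hp m; rewrite ?subrr //.
    exact: dec mn _ eE.
  have := proj_pythagoras (sE n) pmn (y := 0); rewrite !subr0 => ->; last by case: (sE n).
  by rewrite addrK.
have qdec m n : (m <= n)%N -> sqn (p n) <= sqn (p m).
  by move=> mn; rewrite -subr_ge0 -pyth // sqn_ge0.
have cauchy := decreasing_cauchy qdec (fun n => sqn_ge0 (p n)).
have [l lp] : exists l, qcvg p l.
  apply: ip_complete => eps e0; have [N hN] := cauchy _ e0.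
  exists N => m n Nm Nn; rewrite -/(sqn _).
  case: (leqP m n) => [mn|/ltnW nm]; first by rewrite pyth //; exact: hN.
  by rewrite sqnBC pyth //; exact: hN.
have lproj : is_proj (\bigcap_n E n) x l.
  split=> [n _|e eE].
    apply: cE => eps e0; have [N hN] := lp _ e0; exists (p (maxn N n)).
      by have [pE _] := hp (maxn N n); exact: (dec _ _ (leq_maxr N n) _ pE).
    by rewrite sqnBC; apply: hN; exact: leq_maxl.
  apply: ip_eq0C; apply: (@orth_closed e) => eps e0.
  have [N hN] := lp _ e0; exists (x - p N).
    by apply: ip_eq0C; case: (hp N) => _; apply; exact: eE.
  by rewrite opprB addrC addrA subrK; exact: hN.
have sI : subspace (\bigcap_n E n).
  split=> [n _|a u v hu hv n _]; first by case: (sE n).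
  by case: (sE n) => _; apply; [exact: hu|exact: hv].
apply: (qcvg_le lp lp) => n.
have := sqnB_le (p n) l q; rewrite (proj_uniq sI lproj hq) mulr0 addr0 => h.
by apply: le_trans h _; rewrite lerDl mulr_ge0 ?sqn_ge0.
Qed.

(** Projections are contractions, so convergence passes through the three
    factors one at a time. *)
Theorem qcvg_sandwich (E1 E2 : nat -> set V) (P1 P2 : nat -> V -> V)
    (P0 Pi : V -> V) g :
  (forall n, subspace (E1 n)) -> (forall n, subspace (E2 n)) ->
  (forall n, qclosed (E2 n)) -> (forall m n, (m <= n)%N -> E2 n `<=` E2 m) ->
  (forall n x, is_proj (E1 n) x (P1 n x)) -> (forall n x, is_proj (E2 n) x (P2 n x)) ->
  (forall x, is_proj (\bigcap_n E2 n) x (Pi x)) ->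
  (forall x, qcvg (P1 ^~ x) x) -> (forall x, sqn (P0 x - x) = 0) ->
  qcvg (fun n => P1 n (P2 n (P1 n g))) (P0 (Pi (P0 g))).
Proof.
move=> s1 s2 c2 dec h1 h2 hi up h0; set q := P0 g; set r := Pi q.
have contr (E : set V) P x y : subspace E -> (forall x, is_proj E x (P x)) ->
    sqn (P x - P y) <= sqn (x - y).
  by move=> sE hP; apply: (is_proj_le sE); exact: is_projB.
have ha : qcvg (fun n => P1 n g) q.
  apply: (qcvg_le (up g) (qcvg_null (x := fun=> g) (l := q) _)) => n; last exact: sqnB_le.
  by rewrite sqnBC h0.
have hb : qcvg (fun n => P2 n (P1 n g)) r.
  apply: (qcvg_le ha (qcvg_proj_decreasing s2 c2 dec (h2 ^~ q) (hi q))) => n.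
  apply: le_trans (sqnB_le _ (P2 n q) _) _; rewrite lerD2r ler_pM2l //.
  exact: contr (s2 n) (h2 n).
have hc : qcvg (fun n => P1 n (P2 n (P1 n g))) r.
  apply: (qcvg_le hb (up r)) => n.
  apply: le_trans (sqnB_le _ (P1 n r) _) _; rewrite lerD2r ler_pM2l //.
  exact: contr (s1 n) (h1 n).
apply: (qcvg_le hc (qcvg_null (x := fun=> r) (l := P0 r) _)) => n; last exact: sqnB_le.
by rewrite sqnBC h0.
Qed.

Definition below N : pred nat := [pred k | (k < N)%N].

Lemma innov_min f Q l y : tail f Q l.+1 y -> sqn (innov f Q l) <= sqn (f l - y).
Proof.
move=> yT; rewrite (proj_pythagoras (tail_subspace f Q l.+1) (prj_tail f Q l.+1 (f l)) yT).
by rewrite lerDl sqn_ge0.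
Qed.

Lemma innov_mono f (Q Q' : pred nat) l : (forall k, Q k -> Q' k) ->
  sqn (innov f Q' l) <= sqn (innov f Q l).
Proof.
move=> QQ; apply: innov_min; have [pT _] := prj_tail f Q l.+1 (f l).
by apply: cspan_mono pT => k /= /andP[-> /QQ].
Qed.

Lemma innov_approx f l (eps : R) : 0 < eps -> exists n (c : nat -> C),
  sqn (f l - \sum_(k < n | (l < k)%N) c k *: f k) < sqn (innov f xpredT l) + eps.
Proof.
move=> e0; have pP := prj_tail f xpredT l.+1 (f l); have [pT _] := pP.
have [n [c hc]] := pT _ e0; exists n, c.
have -> : \sum_(k < n | (l < k)%N) c k *: f k
    = \sum_(k < n | [pred k | (l < k)%N && xpredT k] k) c k *: f k.
  by apply: eq_bigl => k /=; rewrite andbT.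
rewrite (proj_pythagoras (tail_subspace f xpredT l.+1) pP); last exact: cspan_comb.
by rewrite ltrD2l.
Qed.

Lemma innov_below_limit f l (eps : R) : 0 < eps -> exists N, forall n, (N <= n)%N ->
  sqn (innov f (below n) l) < sqn (innov f xpredT l) + eps.
Proof.
move=> e0; have [N [c hc]] := innov_approx f l e0; exists N => n Nn.
apply: le_lt_trans hc; apply: innov_min.
have -> : \sum_(k < N | (l < k)%N) c k *: f k
  = \sum_(k < N | [pred k | (l < k)%N && below n k] k) c k *: f k.
  by apply: eq_bigl => k; rewrite /below /= (leq_trans (ltn_ord k) Nn) andbT.
exact: cspan_comb.
Qed.
End SemiHilbertTheory.

(** The errors e(l, q) and e(l) are the cases where Q consists of the indices up
    to q and of all indices. *)
HB.lock Definition pred_err (R : realType) (V : lmodType R[i]) (ip : semiHilbert V)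
  (f : nat -> V) (Q : pred nat) l : R := sqn ip (innov ip f Q l).

Section PredictionError.
Context (R : realType) (V : lmodType R[i]) (ip : semiHilbert V) (f : nat -> V).
Implicit Types (Q : pred nat) (l r m : nat).
Local Notation C := R[i].

Lemma pred_errE Q l : pred_err ip f Q l = sqn ip (innov ip f Q l).
Proof. by rewrite pred_err.unlock. Qed.

Lemma pred_err_mono Q Q' l : (forall k, Q k -> Q' k) ->
  pred_err ip f Q' l <= pred_err ip f Q l.
Proof. by rewrite !pred_errE; exact: innov_mono. Qed.

Lemma pred_err_limit l (eps : R) : 0 < eps -> exists N, forall n, (N <= n)%N ->
  pred_err ip f (below n) l < pred_err ip f xpredT l + eps.
Proof.
move=> /(innov_below_limit ip f l) [N h]; exists N => n /h.
by rewrite -!pred_errE.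
Qed.

Lemma gram_pred_err Q r m (p : 'I_m -> V) :
  (forall l, (r <= l < r + m)%N -> Q l) ->
  (forall l, (r <= l < r + m)%N -> pred_err ip f Q l != 0) ->
  (forall j : 'I_m, is_proj ip (tail ip f Q (r + m)) (f (r + j)%N) (p j)) ->
  \det (\matrix_(i, j < m) ip (f (r + j)%N - p j) (f (r + i)%N - p i))
  = (\prod_(l < m) pred_err ip f Q (r + l)%N)%:C%C.
Proof.
move=> hQ hw hp; rewrite (gram_innov hQ _ hp); last by move=> l /hw; rewrite pred_errE.
by under [in RHS]eq_bigr => l _ do rewrite pred_errE.
Qed.

Lemma det_sandwich_pred_err Q r m (P1 P2 : V -> V) (z : C) :
  (forall l, (r <= l < r + m)%N -> Q l) ->
  (forall Q l, pred_err ip f Q l != 0) ->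
  (forall x, is_proj ip (tail ip f (below (r + m)) r) x (P1 x)) ->
  (forall x, is_proj ip (tail ip f Q (r + m)) x (P2 x)) ->
  det_repr ip (fun x => x - P1 (P2 (P1 x))) z <->
  z = (\prod_(l < m) pred_err ip f Q (r + l) / \prod_(l < m) pred_err ip f (below (r + m)) (r + l))%:C%C.
Proof.
move=> hQ hw hP1 hP2.
have E Q' : \prod_(l < m) pred_err ip f Q' (r + l) = \prod_(l < m) sqn ip (innov ip f Q' (r + l)).
  by apply: eq_bigr => l _; exact: pred_errE.
rewrite !E; apply: (@det_sandwich_innov _ _ ip f Q r m P1 P2 z hQ _ _ hP1 hP2) => l _;
  by rewrite -pred_errE.
Qed.

End PredictionError.

(** * Limits of complex sequences and square summable sequences *)

Section ComplexLimits.
Variable R : realType.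
Local Notation C := R[i].

Lemma toC_pos (eps : C) : 0 < eps -> exists2 e : R, 0 < e & eps = e%:C%C.
Proof.
move=> e0; exists (complex.Re eps); last by rewrite RRe_real // gtr0_real.
by move: e0; rewrite ltcE => /andP[].
Qed.

Lemma normR (x : R) : `|x%:C%C| = `|x|%:C%C :> C.
Proof. by rewrite normc_def /= expr0n /= addr0 sqrtr_sqr. Qed.

Lemma cvgCP (u : nat -> C) (l : C) : (u @ \oo --> l) <->
  (forall eps : R, 0 < eps -> exists N, forall n, (N <= n)%N -> `|l - u n| < eps%:C%C).
Proof.
split.
  move/cvgrPdist_lt => h eps e0; have e0' : 0 < eps%:C%C :> C by rewrite ltcR.
  by have [N _ hN] := h _ e0'; exists N => n Nn; exact: hN.
move=> h; apply/cvgrPdist_lt => eps /toC_pos[e e0 ->].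
by have [N hN] := h _ e0; exists N => // n /= Nn; exact: hN.
Qed.

Lemma cvgRP (u : nat -> R) (l : R) : (u @ \oo --> l) <->
  (forall eps : R, 0 < eps -> exists N, forall n, (N <= n)%N -> `|l - u n| < eps).
Proof.
split.
  move/cvgrPdist_lt => h eps e0.
  by have [N _ hN] := h _ e0; exists N => n Nn; exact: hN.
move=> h; apply/cvgrPdist_lt => eps e0.
by have [N hN] := h _ e0; exists N => // n /= Nn; exact: hN.
Qed.

Lemma cvg_toC (u : nat -> R) (l : R) :
  u @ \oo --> l -> (fun n => (u n)%:C%C : C) @ \oo --> (l%:C%C : C).
Proof.
move/cvgRP => h; apply/cvgCP => eps /h[N hN]; exists N => n /hN.
by rewrite -rmorphB normR ltcR.
Qed.

Lemma ReB (z w : C) : complex.Re (z - w) = complex.Re z - complex.Re w.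
Proof. by case: z w => ? ? []. Qed.

Lemma cvg_Re (u : nat -> C) (l : C) :
  u @ \oo --> l -> (fun n => complex.Re (u n)) @ \oo --> complex.Re l.
Proof.
move/cvgCP => h; apply/cvgRP => eps /h[N hN]; exists N => n /hN.
rewrite -ReB.
by rewrite -ltcR; apply: le_lt_trans; exact: normc_ge_Re.
Qed.

Lemma limC_eq (u : nat -> C) (l : C) : u @ \oo --> l -> limn u = l.
Proof. by move=> h; apply: cvg_lim h; exact: norm_hausdorff. Qed.

Lemma series_toC (v : nat -> R) n :
  series (fun i => (v i)%:C%C : C) n = (series v n)%:C%C.
Proof. by rewrite /series /= rmorph_sum. Qed.

Lemma normC_sqmod (z : C) : `|z| ^+ 2 = (sqmod z)%:C%C.
Proof. by rewrite normCK sqmodE. Qed.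

Definition l2seq (v : nat -> C) := cvgn (series (fun i => sqmod (v i))).

Lemma l2seqP (v : nat -> C) : cvgn (series (fun i => `|v i| ^+ 2)) <-> l2seq v.
Proof.
have E : series (fun i => `|v i| ^+ 2) = fun n => (series (fun i => sqmod (v i)) n)%:C%C.
  apply/funext => n; rewrite -series_toC; congr (series _ n).
  by apply/funext => i; exact: normC_sqmod.
rewrite E; split=> [/cvg_ex[/= l /cvg_Re h]|/cvg_ex[/= l h]].
  by apply/cvg_ex; exists (complex.Re l); exact: h.
by apply/cvg_ex; exists (l%:C%C); exact: cvg_toC.
Qed.

Lemma lim_l2 (v : nat -> C) : l2seq v ->
  limn (series (fun i => `|v i| ^+ 2)) = (limn (series (fun i => sqmod (v i))))%:C%C.
Proof.
move=> h; apply: limC_eq.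
have -> : series (fun i => `|v i| ^+ 2) = fun n => (series (fun i => sqmod (v i)) n)%:C%C.
  apply/funext => n; rewrite -series_toC; congr (series _ n).
  by apply/funext => i; exact: normC_sqmod.
exact: cvg_toC.
Qed.

Lemma l2seq_bound (v : nat -> C) (M : R) :
  (forall n, series (fun i => sqmod (v i)) n <= M) -> l2seq v.
Proof.
move=> h; apply: nondecreasing_is_cvgn; last by exists M => _ [n _ <-].
by apply: nondecreasing_series => i _ _; exact: sqmod_ge0.
Qed.

Lemma l2seq_le_lim (v : nat -> C) n : l2seq v ->
  series (fun i => sqmod (v i)) n <= limn (series (fun i => sqmod (v i))).
Proof.
move=> h; apply: nondecreasing_cvgn_le => //.
by apply: nondecreasing_series => i _ _; exact: sqmod_ge0.
Qed.

Lemma l2seqD (v w : nat -> C) a : l2seq v -> l2seq w -> l2seq (fun i => v i + a * w i).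
Proof.
move=> hv hw.
pose M := 2 * limn (series (fun i => sqmod (v i))) + 2 * sqmod a * limn (series (fun i => sqmod (w i))).
apply: (@l2seq_bound _ M) => n.
apply: (@le_trans _ _ (2 * series (fun i => sqmod (v i)) n + 2 * sqmod a * series (fun i => sqmod (w i)) n)).
  rewrite /series /= !mulr_sumr -big_split /=; apply: ler_sum => i _.
  apply: le_trans (sqmodD_le _ _) _; rewrite lerD2l -mulrA ler_pM2l //.
  by rewrite -lecR rmorphM /= !sqmodE rmorphM /= mulrACA.
by apply: lerD; apply: ler_wpM2l; rewrite ?mulr_ge0 ?sqmod_ge0 //; exact: l2seq_le_lim.
Qed.

(** By polarization, the real and imaginary parts are combinations of series of
    squared moduli. *)
Lemma cvg_conj_series (v w : nat -> C) : l2seq v -> l2seq w ->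
  cvgn (series (fun i => (v i)^* * w i)).
Proof.
move=> hv hw; pose S z := series (fun i => sqmod (v i + z * w i)).
pose s1 := series (fun i => sqmod (v i)); pose s2 := series (fun i => sqmod (w i)).
have hS z : cvgn (S z) by exact: l2seqD.
pose u n : C := (2^-1 * (S 1 n - s1 n - s2 n))%:C%C + 'i%C * (2^-1 * (S (- 'i%C) n - s1 n - s2 n))%:C%C.
have -> : series (fun i => (v i)^* * w i) = u.
  apply/funext => n; rewrite /u /S /s1 /s2 /series /= -!sumrB !mulr_sumr !rmorph_sum mulr_sumr -big_split /=.
  apply: eq_bigr => i _; case: (v i) (w i) => [a b] [c d].
  by apply/eqP; rewrite eq_complex /sqmod /=; apply/andP; split; apply/eqP; field.
apply/cvg_ex; exists ((2^-1 * (limn (S 1) - limn s1 - limn s2))%:C%C + 'i%C * (2^-1 * (limn (S (- 'i%C)) - limn s1 - limn s2))%:C%C).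
have hR z : (fun n => 2^-1 * (S z n - s1 n - s2 n)) @ \oo --> 2^-1 * (limn (S z) - limn s1 - limn s2).
  by apply: cvgMr; apply: cvgB; [apply: cvgB|]; [exact: hS|exact: hv|exact: hw].
by apply: cvgD; [|apply: cvgMr]; apply: cvg_toC; exact: hR.
Qed.

Lemma cvg_sumC (n : nat) (u : 'I_n -> nat -> C) (l : 'I_n -> C) :
  (forall i, u i @ \oo --> l i) -> (fun k => \sum_i u i k) @ \oo --> \sum_i l i.
Proof.
elim: n u l => [|n IH] u l h.
  rewrite big_ord0 (_ : (fun k => _) = fun=> 0); first exact: cvg_cst.
  by apply/funext => k; rewrite big_ord0.
rewrite big_ord_recr /= (_ : (fun k => _) =
    (fun k => \sum_i u (widen_ord (leqnSn n) i) k + u ord_max k)).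
  by apply: cvgD (h ord_max); apply: IH => i; exact: h.
by apply/funext => k; rewrite big_ord_recr.
Qed.

Definition qform (K : nat -> nat -> C) n (c : nat -> C) : C :=
  \sum_(i < n) \sum_(j < n) (c i)^* * K i j * c j.
Definition lcomb (Theta : nat -> nat -> C) n (c : nat -> C) l : C :=
  \sum_(j < n) c j * Theta l j.

Lemma qform_kernel_of (Theta : nat -> nat -> C) n (c : nat -> C) :
  (forall j, l2seq (column Theta j)) ->
  l2seq (lcomb Theta n c) /\
  qform (kernel_of Theta) n c = (limn (series (fun l => sqmod (lcomb Theta n c l))))%:C%C.
Proof.
move=> h; have h2 : l2seq (lcomb Theta n c).
  rewrite /lcomb; elim: n => [|n IH].
    apply: (@l2seq_bound _ 0) => n; rewrite /series /= big1 // => i _.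
    by rewrite big_ord0 /sqmod /= expr0n /= addr0.
  have -> : (fun l => \sum_(j < n.+1) c j * Theta l j)
      = (fun l => \sum_(j < n) c j * Theta l j + c n * column Theta n l).
    by apply/funext => l; rewrite big_ord_recr.
  exact: l2seqD.
split => //; rewrite -lim_l2 //; apply/esym/limC_eq.
have -> : series (fun i => `|lcomb Theta n c i| ^+ 2) = fun N => \sum_(i < n) \sum_(j < n)
    ((c i)^* * series (fun l => (column Theta i l)^* * column Theta j l) N * c j).
  apply/funext => N; rewrite /series /=.
  under [RHS]eq_bigr => i _.
    under eq_bigr => j _ do rewrite mulr_sumr mulr_suml.
    rewrite exchange_big /=; over.
  rewrite exchange_big /=; apply: eq_bigr => l _.
  rewrite normCKC /lcomb rmorph_sum mulr_suml; apply: eq_bigr => i _.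
  by rewrite mulr_sumr; apply: eq_bigr => j _; rewrite rmorphM /= /column; ring.
apply: cvg_sumC => i; apply: cvg_sumC => j.
by apply: cvgMl; apply: cvgMr; exact: cvg_conj_series.
Qed.

Lemma cvg_series_single (r : nat) (a : R) :
  series (fun i => if i == r then a else 0) @ \oo --> a.
Proof.
apply/cvgRP => eps e0; exists r.+1 => n rn.
rewrite /series /= (bigD1_seq r) ?iota_uniq ?mem_index_iota //= eqxx big1 ?addr0 ?subrr ?normr0 //.
by move=> i /negbTE ->.
Qed.

Lemma limR_eq (u : nat -> R) (l : R) : u @ \oo --> l -> limn u = l.
Proof. by move=> h; apply: cvg_lim h; exact: norm_hausdorff. Qed.
End ComplexLimits.

(** * The diagonal of the spectral factor *)

Section SpectralFactorDiagonal.
Context (R : realType) (V : lmodType R[i]) (ip : semiHilbert V) (f : nat -> V).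
Local Notation C := R[i].

Definition gramK (m n : nat) : C := ip (f n) (f m).

Lemma qform_gramK n (c : nat -> C) :
  qform gramK n c = (sqn ip (\sum_(j < n) c j *: f j))%:C%C.
Proof.
rewrite -ipE ip_sumr /qform; apply: eq_bigr => i _.
rewrite ip_suml; apply: eq_bigr => j _.
by rewrite ipZr ipZl /gramK; ring.
Qed.

Lemma le_kernelP (K1 K2 : nat -> nat -> C) :
  le_kernel K1 K2 <-> forall n c, qform K1 n c <= qform K2 n c.
Proof.
suff E n (c : nat -> C) : \sum_(i < n) \sum_(j < n) (c i)^* * (K2 i j - K1 i j) * c j
    = qform K2 n c - qform K1 n c.
  by split=> h n c; have := h n c; rewrite E subr_ge0.
rewrite /qform -sumrB; apply: eq_bigr => i _; rewrite -sumrB.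
by apply: eq_bigr => j _; ring.
Qed.

(** The coefficients of the combination f_r - \sum_(r < k < n) c_k f_k. *)
Definition pivot r n (c : nat -> C) k : C :=
  if k == r then 1 else if (r < k < n)%N then - c k else 0.

Lemma sum_pivot (W : lmodType C) (u : nat -> W) r n (c : nat -> C) :
  \sum_(k < maxn n r.+1) pivot r n c k *: u k = u r - \sum_(k < n | (r < k)%N) c k *: u k.
Proof.
set N := maxn n r.+1; have rN : (r < N)%N by rewrite leq_max leqnn orbT.
rewrite (big_ord_widen_cond N (fun k => r < k)%N (fun k => c k *: u k)); last exact: leq_maxl.
rewrite (bigD1 (Ordinal rN)) //= /pivot eqxx scale1r; congr (_ + _).
rewrite -sumrN big_mkcond [RHS]big_mkcond; apply: eq_bigr => k _ /=.
rewrite -val_eqE /=; case: eqP => [->|_] /=; first by rewrite ltnn.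
by case: ifP; rewrite ?scale0r ?scaleNr.
Qed.

Lemma lcomb_pivot (T : nat -> nat -> C) r n (c : nat -> C) l :
  lcomb T (maxn n r.+1) (pivot r n c) l = T l r - \sum_(k < n | (r < k)%N) c k * T l k.
Proof. exact: (@sum_pivot C^o (T l) r n c). Qed.

Lemma lower_triangular_l2 F (T : nat -> nat -> C) : lower_triangular F T ->
  forall j, l2seq (column T j).
Proof. by move=> h j; apply/l2seqP; case: (h j). Qed.

Lemma lower_triangular0 F (T : nat -> nat -> C) k j : lower_triangular F T ->
  (k < j)%N -> T k j = 0.
Proof. by move=> h kj; case: (h j) => + _; apply; rewrite leqNgt kj andbF. Qed.

(** In row r only column r contributes to a combination with pivot r, so its
    squared norm is at least |T_{r,r}|^2. *)
Lemma diag_le_innov F T r : lower_triangular F T -> le_kernel (kernel_of T) gramK ->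
  sqmod (T r r) <= sqn ip (innov ip f xpredT r).
Proof.
move=> lt /le_kernelP le; apply/ler_addgt0Pr => eps e0.
have [n [c hc]] := innov_approx ip f r e0; apply: le_trans (ltW hc).
have [h1 h2] := qform_kernel_of (maxn n r.+1) (pivot r n c) (lower_triangular_l2 lt).
have := le (maxn n r.+1) (pivot r n c); rewrite h2 qform_gramK sum_pivot lecR.
apply: le_trans; move: (l2seq_le_lim r.+1 h1); apply: le_trans.
have -> : sqmod (T r r) = sqmod (lcomb T (maxn n r.+1) (pivot r n c) r).
  by rewrite lcomb_pivot big1 ?subr0 // => k rk; rewrite (lower_triangular0 lt) ?mulr0.
rewrite /series /= big_nat_recr //= lerDr.
by apply: sumr_ge0 => i _; exact: sqmod_ge0.
Qed.

(** The coefficients of the f_j along the normalized innovation of f_r, as an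
    array whose only nonzero row is the r-th.  By the Cauchy-Schwarz inequality
    its kernel is below that of the process. *)
Definition rank1 r (i j : nat) : C :=
  if i == r then ip (f j) (innov ip f xpredT r) / (Num.sqrt (sqn ip (innov ip f xpredT r)))%:C%C
  else 0.

Lemma rank1_out r i j : (r < j)%N -> rank1 r i j = 0.
Proof.
move=> rj; rewrite /rank1; case: ifP => // _.
by rewrite ip_eq0C ?mul0r //; apply: innov_orth; exact: tail_mem.
Qed.

Lemma ip_innov_self r : ip (f r) (innov ip f xpredT r) = (sqn ip (innov ip f xpredT r))%:C%C.
Proof.
have [pT _] := prj_tail ip f xpredT r.+1 (f r).
have e : f r = innov ip f xpredT r + prj ip (tail ip f xpredT r.+1) (f r) by rewrite subrK.
by rewrite {1}e ipDl (ip_eq0C (innov_orth pT)) addr0 ipE.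
Qed.

Lemma rank1_lower r : lower_triangular (pred1 r) (rank1 r).
Proof.
move=> j; split=> [i|].
  rewrite negb_and /column => /orP[/= ir|]; first by rewrite /rank1 (negbTE ir).
  rewrite -ltnNge => ij; rewrite /rank1; case: eqP => // ir; subst i.
  by have := rank1_out r ij; rewrite /rank1 eqxx.
apply/l2seqP; apply: (cvgP (sqmod (rank1 r r j))).
have -> : (fun i => sqmod (column (rank1 r) j i)) = (fun i => if i == r then sqmod (rank1 r r j) else 0).
  apply/funext => i; rewrite /column; case: eqP => [->//|/eqP ir].
  by rewrite /rank1 (negbTE ir) /sqmod /= expr0n /= addr0.
exact: cvg_series_single.
Qed.

Lemma rank1_outer r : 0 < sqn ip (innov ip f xpredT r) -> outer (pred1 r) (rank1 r).
Proof.
move=> w0; split; first exact: rank1_lower.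
move=> k v [v0 _] eps e0; set w := sqn _ _ in w0.
have d0 : rank1 r r r != 0.
  rewrite /rank1 eqxx ip_innov_self mulf_neq0 ?invr_eq0 // (inj_eq (@complexI _) _ 0) gt_eqF //.
  by rewrite sqrtr_gt0.
exists r.+1, (fun j => (j == r)%:R * (v r / rank1 r r r)).
have -> : (fun i => v i - \sum_(j < r.+1 | (k <= j)%N) (j == r :> nat)%:R * (v r / rank1 r r r) * column (rank1 r) j i) = fun=> 0.
  apply/funext => i; rewrite big_mkcond /= big_ord_recr /= eqxx mul1r big1 ?add0r => [|j _]; last first.
    by rewrite (ltn_eqF (ltn_ord j)) !mul0r; case: ifP.
  have [->|ir] := eqVneq i r.
    case: ifP => kr; first by rewrite /column divfK // subrr.
    by rewrite v0 ?subrr // /= kr andbF.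
  rewrite v0 /= ?(negbTE ir) // /column /rank1 (negbTE ir) mulr0.
  by case: ifP; rewrite subrr.
have -> : @l2norm R (fun=> 0) = 0 => //.
rewrite /l2norm; have -> : series (fun i : nat => `|0 : C| ^+ 2) = fun=> 0.
  by apply/funext => n; rewrite /series /= big1 // => i _; rewrite normr0 expr0n.
by rewrite lim_cst ?sqrtC0.
Qed.

Lemma qform_rank1 r n (c : nat -> C) :
  qform (kernel_of (rank1 r)) n c = (sqmod (lcomb (rank1 r) n c r))%:C%C.
Proof.
have [_ ->] := qform_kernel_of n c (lower_triangular_l2 (@rank1_lower r)).
congr (_%:C%C); apply: limR_eq.
have -> : (fun l => sqmod (lcomb (rank1 r) n c l)) = (fun l => if l == r then sqmod (lcomb (rank1 r) n c r) else 0).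
  apply/funext => l; case: eqP => [->//|/eqP lr].
  by rewrite /lcomb big1 /sqmod /= ?expr0n /= ?addr0 // => j _; rewrite /rank1 (negbTE lr) mulr0.
exact: cvg_series_single.
Qed.

Lemma rank1_le r : 0 < sqn ip (innov ip f xpredT r) -> le_kernel (kernel_of (rank1 r)) gramK.
Proof.
move=> w0; apply/le_kernelP => n c; rewrite qform_rank1 qform_gramK lecR.
set g := \sum_(j < n) _; set w := innov _ _ _ _ in w0 *.
have -> : lcomb (rank1 r) n c r = ip g w / (Num.sqrt (sqn ip w))%:C%C.
  rewrite /lcomb /rank1 eqxx /g ip_suml mulr_suml.
  by apply: eq_bigr => j _; rewrite ipZl mulrA.
have q0 : sqn ip w != 0 by rewrite gt_eqF.
have -> : sqmod (ip g w / (Num.sqrt (sqn ip w))%:C%C) = sqmod (ip g w) / sqn ip w.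
  apply: complexI; rewrite sqmodE rmorphM /= rmorphM /= mulrACA -sqmodE; congr (_ * _).
  by rewrite -rmorphV /= ?unitfE ?gt_eqF ?sqrtr_gt0 // conj_real -rmorphM -invfM -expr2 sqr_sqrtr // ltW.
by rewrite ler_pdivrMr // cauchy_schwarz.
Qed.

(** Testing the maximality of T against [rank1] suffices: a combination with
    pivot r of columns of T can be brought close to T_{r,r} times the r-th basis
    vector because T is outer, while on the columns of [rank1] it always has the
    squared norm of the innovation. *)
Theorem spectral_factor_innov F T r : spectral_factor gramK F T ->
  `|T r r| ^+ 2 = (sqn ip (innov ip f xpredT r))%:C%C.
Proof.
case=> [[lt tot] le max _]; rewrite normC_sqmod; congr (_%:C%C).
apply/eqP; rewrite eq_le (diag_le_innov r lt le) /=; set w := sqn _ _.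
have [w0|w0] := eqVneq w 0; first by rewrite w0 sqmod_ge0.
have {}w0 : 0 < w by rewrite lt_neqAle eq_sym w0 sqn_ge0.
have /le_kernelP hle := max _ _ (rank1_outer w0) (rank1_le w0).
apply/ler_addgt0Pr => eps e0.
pose v i := if (r < i)%N then T i r else 0.
have vF : in_dsum F r.+1 v.
  have [h1 h2] := lt r; split=> [i|].
    rewrite /v; case: ifP => // ri; rewrite andbT => Fi.
    by apply: h1; rewrite negb_and Fi.
  apply/l2seqP; apply: (@l2seq_bound _ _ (limn (series (fun i => sqmod (column T r i))))) => n.
  move: (l2seq_le_lim n (lower_triangular_l2 (j := r) lt)); apply: le_trans.
  rewrite /series /=; apply: ler_sum => i _; rewrite /v /column; case: ifP => // _.
  by rewrite [X in X <= _]/sqmod /= expr0n /= addr0 sqmod_ge0.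
have s0 : 0 < (Num.sqrt eps)%:C%C :> C by rewrite ltcR sqrtr_gt0.
have [n [c hc]] := tot _ _ vF _ s0.
pose z i := v i - \sum_(j < n | (r < j)%N) c j * column T j i.
pose N := maxn n r.+1; pose u := lcomb T N (pivot r n c).
have uE l : sqmod (u l) = (if l == r then sqmod (T r r) else 0) + sqmod (z l).
  rewrite /u lcomb_pivot /z /v; case: (ltngtP r l) => [rl|lr|<-].
  - by rewrite add0r.
  - rewrite add0r (lower_triangular0 lt lr).
    by [].
  - rewrite big1 => [|k rk]; last by rewrite (lower_triangular0 lt rk) mulr0.
    by rewrite !subr0 [X in _ + X]/sqmod /= expr0n /= !addr0.
have [ul2 uq] := qform_kernel_of N (pivot r n c) (lower_triangular_l2 lt).
have zl2 : l2seq z.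
  apply: (@l2seq_bound _ _ (limn (series (fun i => sqmod (u i))))) => m.
  move: (l2seq_le_lim m ul2); apply: le_trans; rewrite /series /=; apply: ler_sum => i _.
  by rewrite -/u uE lerDr; case: ifP => // _; exact: sqmod_ge0.
have ulim : limn (series (fun i => sqmod (u i))) = sqmod (T r r) + limn (series (fun i => sqmod (z i))).
  apply: limR_eq; have -> : series (fun i => sqmod (u i))
     = fun m => series (fun l => if l == r then sqmod (T r r) else 0) m + series (fun i => sqmod (z i)) m.
    by apply/funext => m; rewrite /series /= -big_split; apply: eq_bigr => i _; exact: uE.
  by apply: cvgD; [exact: cvg_series_single|exact: zl2].
have zlim : limn (series (fun i => sqmod (z i))) <= eps.
  rewrite -lecR -lim_l2 // ltW // -[ltLHS]sqrtCK -(sqr_sqrtr (ltW e0)) rmorphXn /=.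
  apply: ltrXn2r => //; rewrite sqrtC_ge0 lim_l2 // ler0c.
  move: (l2seq_le_lim 0 zl2); apply: le_trans; by rewrite /series /= big_nil.
have := hle N (pivot r n c); rewrite qform_rank1 uq lecR ulim lcomb_pivot.
rewrite big1 => [|k rk]; last by rewrite rank1_out ?mulr0.
rewrite subr0 => h; have {h} : sqmod (rank1 r r r) <= sqmod (T r r) + eps.
  by apply: le_trans h _; rewrite lerD2l.
suff -> : sqmod (rank1 r r r) = w by [].
apply: complexI; rewrite sqmodE /rank1 eqxx ip_innov_self -/w.
rewrite -rmorphV /= ?unitfE ?gt_eqF ?sqrtr_gt0 // -rmorphM conj_real -rmorphM /=; congr (_%:C%C).
by rewrite -{1 3}(sqr_sqrtr (ltW w0)) expr2 mulfK ?gt_eqF ?sqrtr_gt0 // -expr2 sqr_sqrtr // ltW.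
Qed.

End SpectralFactorDiagonal.

(** * Completeness of the space of square integrable functions *)

Section RealL2.
Context (R : realType) (d : measure_display) (T : measurableType d).
Variable mu : probability T R.
Implicit Types u v : T -> R.

Lemma lfun2_measurable u : u \in Lfun mu 2%:E -> measurable_fun setT u.
Proof. by rewrite inE => /andP[/[!inE]]. Qed.

Lemma lfun2_lin u v (a b : R) : u \in Lfun mu 2%:E -> v \in Lfun mu 2%:E ->
  (fun x => a * u x + b * v x) \in Lfun mu 2%:E.
Proof.
move=> hu hv; have [h0 h] := Lfun_submod_closed mu (@lee1n R 2).
have hbv : b *: v \in Lfun mu 2%:E by rewrite -[b *: v]addr0; exact: h.
rewrite (_ : (fun x => _) = a *: u + b *: v); first exact: h.
exact/funext.
Qed.

Lemma lfun2B u v : u \in Lfun mu 2%:E -> v \in Lfun mu 2%:E ->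
  (fun x => u x - v x) \in Lfun mu 2%:E.
Proof.
move=> hu hv; rewrite (_ : (fun x => _) = fun x => 1 * u x + -1 * v x); first exact: lfun2_lin.
by apply/funext => x; rewrite mul1r mulN1r.
Qed.

Definition rip u v : R := \int[mu]_x (u x * v x).

Lemma rip_integrable u v : u \in Lfun mu 2%:E -> v \in Lfun mu 2%:E ->
  mu.-integrable setT (EFin \o (fun x => u x * v x)).
Proof. by move=> hu hv; apply/Lfun1_integrable; exact: Lfun2_mul_Lfun1. Qed.

Lemma ripC u v : rip u v = rip v u.
Proof. by apply: eq_Rintegral => x _; rewrite mulrC. Qed.

Lemma rip_linl u v w (a b : R) : u \in Lfun mu 2%:E -> v \in Lfun mu 2%:E -> w \in Lfun mu 2%:E ->
  rip (fun x => a * u x + b * v x) w = a * rip u w + b * rip v w.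
Proof.
move=> hu hv hw; rewrite /rip.
transitivity (\int[mu]_x (a * (u x * w x) + b * (v x * w x))).
  by apply: eq_Rintegral => x _; rewrite mulrDl !mulrA.
have iz (c : R) u' : u' \in Lfun mu 2%:E -> mu.-integrable setT (EFin \o (fun x => c * (u' x * w x))).
  move=> h; have := integrableZl measurableT c (rip_integrable h hw).
  by congr (integrable _ _ _); apply/funext => x /=; rewrite EFinM.
by rewrite RintegralD ?RintegralZl //; try exact: iz; exact: rip_integrable.
Qed.

Lemma rip_EFin u : u \in Lfun mu 2%:E -> (\int[mu]_x (u x ^+ 2)%:E)%E = (rip u u)%:E.
Proof.
move=> hu; rewrite /rip /Rintegral fineK.
  by apply: eq_integral => x _; rewrite expr2.
by apply: integrable_fin_num => //; exact: rip_integrable.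
Qed.

Lemma rip_ge0 u : 0 <= rip u u.
Proof. by apply: Rintegral_ge0 => x _; rewrite -expr2 sqr_ge0. Qed.

Lemma rip_eq0_ae u : u \in Lfun mu 2%:E -> rip u u = 0 -> {ae mu, forall x, u x = 0}.
Proof.
move=> hu u0; have mu2 : measurable_fun setT ((fun x => (u x ^+ 2)%:E) : T -> \bar R).
  by apply/measurable_EFinP; apply: measurable_funX; exact: lfun2_measurable.
have : (\int[mu]_x `|(u x ^+ 2)%:E|)%E = 0%E.
  rewrite -[RHS](congr1 EFin u0) -rip_EFin //.
  by apply: eq_integral => x _; rewrite gee0_abs // lee_fin sqr_ge0.
move/(ae_eq_integral_abs mu measurableT mu2); apply: filterS => x /(_ I) [].
by move/eqP; rewrite sqrf_eq0 => /eqP.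
Qed.

Lemma lfun2_intro u : measurable_fun setT u -> (\int[mu]_x (u x ^+ 2)%:E < +oo)%E ->
  u \in Lfun mu 2%:E.
Proof.
move=> mf h; rewrite inE; apply/andP; split; rewrite inE //=.
rewrite /finite_norm unlock /Lnorm poweR_lty //.
by under eq_integral => x _ do rewrite /= powR_mulrn ?normr_ge0 // real_normK ?num_real //.
Qed.

Lemma cvg_realE (w : nat -> R) (L : R) : w @ \oo --> L ->
  (fun k => (w k)%:E) @ \oo --> L%:E.
Proof. by move=> h; apply/fine_cvgP; split; [exact: nearW|exact: h]. Qed.

(** Riesz-Fischer.  On a probability space the L^1 norm of a difference is
    controlled by its L^2 norm, so along a fast subsequence the differences are
    absolutely summable almost everywhere; Fatou's lemma then bounds the distance
    to the limit. *)
Theorem rip_complete (u : nat -> T -> R) : (forall n, u n \in Lfun mu 2%:E) ->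
  (forall eps : R, 0 < eps -> exists N, forall m n, (N <= m)%N -> (N <= n)%N ->
    rip (fun x => u m x - u n x) (fun x => u m x - u n x) < eps) ->
  exists2 l, l \in Lfun mu 2%:E & forall eps : R, 0 < eps -> exists N, forall n, (N <= n)%N ->
    rip (fun x => u n x - l x) (fun x => u n x - l x) < eps.
Proof.
move=> hu cauchy; pose q (v : T -> R) := rip v v.
pose c k : R := 1 / 2 ^+ k.+1.
have c0 k : 0 < c k by rewrite divr_gt0 // exprn_gt0.
have pick k : {N | forall m n, (N <= m)%N -> (N <= n)%N -> q (fun x => u m x - u n x) < c k ^+ 2}.
  by apply: cid; apply: cauchy; rewrite exprn_gt0.
pose phi k := \max_(i < k.+1) sval (pick i).
have phiP k m n : (phi k <= m)%N -> (phi k <= n)%N -> q (fun x => u m x - u n x) < c k ^+ 2.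
  have hk : (sval (pick k) <= phi k)%N by apply: (leq_bigmax (ord_max : 'I_k.+1)).
  by move=> hm hn; apply: (svalP (pick k)); apply: leq_trans hk _.
have phiS k : (phi k <= phi k.+1)%N by rewrite /phi [X in (_ <= X)%N]big_ord_recr leq_maxl.
pose v k := u (phi k); have hv k : v k \in Lfun mu 2%:E by exact: hu.
have vq k : q (fun x => v k.+1 x - v k x) < c k ^+ 2 by apply: phiP.
pose a k x := `|v k.+1 x - v k x|.
have ma k : measurable_fun setT ((fun x => (a k x)%:E) : T -> \bar R).
  by apply/measurable_EFinP; apply: measurableT_comp => //; apply: lfun2_measurable; exact: lfun2B.
(* |y| <= c / 2 + y^2 / (2 c), integrated against a probability. *)
have ia k : (\int[mu]_x (a k x)%:E <= (c k)%:E)%E.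
  pose w x := v k.+1 x - v k x; have hw : w \in Lfun mu 2%:E by exact: lfun2B.
  have mw2 : measurable_fun setT ((fun x => (w x ^+ 2)%:E) : T -> \bar R).
    by apply/measurable_EFinP; apply: measurable_funX; exact: lfun2_measurable.
  apply: (@le_trans _ _ (\int[mu]_x ((c k / 2)%:E + ((2 * c k)^-1)%:E * (w x ^+ 2)%:E))%E).
    apply: ge0_le_integral => //.
    - by move=> x _; rewrite lee_fin normr_ge0.
    - by apply: emeasurable_funD => //; exact: measurable_funeM.
    - move=> x _; rewrite -EFinM -EFinD lee_fin /a -/(w x).
      rewrite -subr_ge0 -(@real_normK _ (w x)) ?num_real //; set y := `|_|.
      have ck := c0 k; have -> : c k / 2 + (2 * c k)^-1 * y ^+ 2 - y = (y - c k) ^+ 2 / (2 * c k).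
        by field; rewrite gt_eqF.
      by rewrite divr_ge0 ?sqr_ge0 // mulr_ge0 // ltW.
  have ck2 : 0 <= (2 * c k)^-1 by rewrite invr_ge0 mulr_ge0 // ltW.
  rewrite ge0_integralD //; first last.
  - exact: measurable_funeM.
  - by move=> x _; rewrite mule_ge0 // lee_fin sqr_ge0.
  - by move=> x _; rewrite lee_fin divr_ge0 // ltW.
  have -> : (\int[mu]_x (c k / 2)%:E = (c k / 2)%:E)%E.
    by rewrite integral_cst // -[RHS]mule1; congr (_ * _)%E; exact: probability_setT.
  rewrite ge0_integralZl //; first last.
  - by move=> x _; rewrite lee_fin sqr_ge0.
  rewrite rip_EFin // -EFinM -EFinD lee_fin.
  have ck : c k / 2 + (2 * c k)^-1 * c k ^+ 2 = c k by field; rewrite gt_eqF.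
  by rewrite -[leRHS]ck lerD2l ler_wpM2l // ltW // vq.
pose h x := (\sum_(0 <= k <oo) (a k x)%:E)%E.
have a0 k x : (0 <= (a k x)%:E)%E by rewrite lee_fin normr_ge0.
have mh : measurable_fun setT h by exact: ge0_emeasurable_sum.
have ih : (\int[mu]_x h x < +oo)%E.
  rewrite /h integral_nneseries //.
  apply: (@le_lt_trans _ _ 1%:E%E); last exact: ltry.
  apply: (@le_trans _ _ (\sum_(0 <= k <oo) (0 + (1 / (2 ^ k.+1)%:R)%:E))%E).
    apply: lee_nneseries => [k _ _|k _]; first by apply: integral_ge0 => x _; exact: a0.
    by rewrite add0e natrX; exact: ia.
  apply: le_trans (epsilon_trick _ _ _) _ => //.
  by rewrite eseries0 ?add0e.
have h0 x : (0 <= h x)%E by apply: nneseries_ge0 => k _ _; exact: a0.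
have hint : mu.-integrable setT h.
  apply/integrableP; split => //.
  by under eq_integral => x _ do rewrite gee0_abs //.
(* The upper limit is measurable everywhere, and it is the limit wherever there
   is one. *)
pose l x := fine (limn_esup (fun k => (v k x)%:E)).
have ml : measurable_fun setT l.
  apply: (measurableT_comp (fine_measurable measurableT)).
  apply: measurable_fun_limn_esup => k.
  by apply/measurable_EFinP; exact: lfun2_measurable.
have good : {ae mu, forall x, (fun k => v k x) @ \oo --> l x}.
  apply: filterS (integrable_ae measurableT hint) => x /(_ I) hx.
  have : cvgn (series (telescope (v ^~ x))).
    apply: normed_cvg; apply: nondecreasing_is_cvgn.
      by apply: nondecreasing_series => k _ _; exact: normr_ge0.
    exists (fine (h x)) => _ [n _ <-]; rewrite -lee_fin fineK //.
    have := nneseries_lim_ge (u_ := fun k => (a k x)%:E) (P := xpredT) (m := 0%N) n (fun k _ _ => a0 k x).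
    by rewrite -sumEFin.
  move/cvg_ex => [/= L hL].
  have vL : (fun k => v k x) @ \oo --> v 0%N x + L.
    rewrite (_ : (fun k => v k x) = (fun k => v 0%N x + series (telescope (v ^~ x)) k)).
      by apply: cvgD => //; exact: cvg_cst.
    by apply/funext => k; exact: (eq_sum_telescope (v ^~ x)).
  suff -> : l x = v 0%N x + L by [].
  by rewrite /l; have [_ ->] := cvg_limn_einf_sup (cvg_realE vL).
have key n j : (phi j <= n)%N -> (\int[mu]_x ((u n x - l x) ^+ 2)%:E <= (c j ^+ 2)%:E)%E.
  move=> jn; pose F k x := ((u n x - v k x) ^+ 2)%:E.
  have mF k : measurable_fun setT (F k).
    by apply/measurable_EFinP; apply: measurable_funX; apply: lfun2_measurable; exact: lfun2B.
  have F0 k x : setT x -> (0 <= F k x)%E by move=> _; rewrite lee_fin sqr_ge0.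
  have -> : (\int[mu]_x ((u n x - l x) ^+ 2)%:E = \int[mu]_x limn_einf (F ^~ x))%E.
    apply: ae_eq_integral => //.
    - apply/measurable_EFinP; apply: measurable_funX; apply: measurable_funB => //.
      exact: lfun2_measurable.
    - have msup : measurable_fun setT (fun x => limn_esup (fun k => - F k x)%E).
        have mN k : measurable_fun setT (fun x => - F k x)%E.
          exact: (measurableT_comp (@oppe_measurable R setT) (mF k)).
        exact: (measurable_fun_limn_esup mN).
      exact: (measurableT_comp (@oppe_measurable R setT) msup).
    apply: filterS good => x vx _ /=.
    have Fx : (fun k => (u n x - v k x) ^+ 2) @ \oo --> (u n x - l x) ^+ 2.
      under eq_fun do rewrite expr2.
      by rewrite expr2; apply: cvgM; apply: cvgB => //; exact: cvg_cst.
    by have [-> _] := cvg_limn_einf_sup (cvg_realE Fx).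
  apply: le_trans (fatou mu measurableT mF F0) _.
  rewrite limn_einf_lim; apply: lime_le; first exact: is_cvg_einfs.
  exists j => // k /= jk; apply: (@le_trans _ _ (\int[mu]_x F k x)%E).
    by apply: ereal_inf_lbound; exists k => /=.
  rewrite rip_EFin ?lee_fin; last exact: lfun2B.
  apply: ltW; apply: phiP => //.
  elim: k jk => [|k IH]; first by rewrite leqn0 => /eqP ->.
  rewrite leq_eqVlt => /orP[/eqP -> //|]; rewrite ltnS => /IH h'; exact: leq_trans h' (phiS k).
have hul n j : (phi j <= n)%N -> (fun x => u n x - l x) \in Lfun mu 2%:E.
  move=> jn; apply: lfun2_intro; last by apply: le_lt_trans (key n j jn) _; exact: ltry.
  by apply: measurable_funB => //; exact: lfun2_measurable.
exists l.
  have := lfun2B (hu (phi 0%N)) (hul _ 0%N (leqnn _)).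
  by rewrite (_ : (fun x => _) = l) //; apply/funext => x; rewrite opprB addrC subrK.
move=> eps e0.
have [j hj] : exists j, c j ^+ 2 < eps.
  exists (Num.truncn eps^-1); set j := Num.truncn _.
  have c1 : c j <= 1 by rewrite /c ler_pdivrMr ?exprn_gt0 // mul1r exprn_ege1 // ler1n.
  apply: (@le_lt_trans _ _ (c j)); first by rewrite expr2 ler_piMr // ltW.
  rewrite /c div1r invf_plt ?posrE ?exprn_gt0 //.
  apply: lt_trans (truncnS_gt _) _; rewrite -natrX ltr_nat; exact: ltn_expl.
exists (phi j) => n jn; apply: le_lt_trans hj.
by rewrite -lee_fin -rip_EFin ?key //; exact: hul jn.
Qed.

End RealL2.

Section ComplexL2.
Context (R : realType) (d : measure_display) (T : measurableType d).
Variable mu : probability T R.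
Local Notation C := R[i].
Implicit Types g h : T -> C.
Local Notation Re g := (fun x => complex.Re (g x)).
Local Notation Im g := (fun x => complex.Im (g x)).

Lemma ReD (z w : C) : complex.Re (z + w) = complex.Re z + complex.Re w.
Proof. by case: z w => ? ? []. Qed.
Lemma ImD (z w : C) : complex.Im (z + w) = complex.Im z + complex.Im w.
Proof. by case: z w => ? ? []. Qed.
Lemma ImB (z w : C) : complex.Im (z - w) = complex.Im z - complex.Im w.
Proof. by case: z w => ? ? []. Qed.
Lemma ReM (z w : C) : complex.Re (z * w) =
  complex.Re z * complex.Re w - complex.Im z * complex.Im w.
Proof. by case: z w => ? ? []. Qed.
Lemma ImM (z w : C) : complex.Im (z * w) =
  complex.Re z * complex.Im w + complex.Im z * complex.Re w.
Proof. by case: z w => ? ? []. Qed.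

Lemma L2_lin (a : C) g h : L2 mu g -> L2 mu h -> L2 mu (fun x => a * g x + h x).
Proof.
move=> [g1 g2] [h1 h2]; split.
  rewrite (_ : (fun x => _) = fun x => 1 * (complex.Re a * complex.Re (g x)
      + (- complex.Im a) * complex.Im (g x)) + 1 * complex.Re (h x)).
    by apply: lfun2_lin => //; exact: lfun2_lin.
  by apply/funext => x; rewrite ReD ReM !mul1r mulNr.
rewrite (_ : (fun x => _) = fun x => 1 * (complex.Re a * complex.Im (g x)
    + complex.Im a * complex.Re (g x)) + 1 * complex.Im (h x)).
  by apply: lfun2_lin => //; exact: lfun2_lin.
by apply/funext => x; rewrite ImD ImM !mul1r.
Qed.

Lemma L2_0 : L2 mu (fun=> 0).
Proof. by split => /=; exact: (Lfun_submod_closed mu (@lee1n R 2)).1. Qed.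

Lemma innerE g h : L2 mu g -> L2 mu h -> inner mu g h =
  Complex (rip mu (Re g) (Re h) + rip mu (Im g) (Im h))
          (rip mu (Im g) (Re h) - rip mu (Re g) (Im h)).
Proof.
move=> [g1 g2] [h1 h2]; rewrite /inner /integralC; congr Complex.
  rewrite -RintegralD ?rip_integrable //; try exact: rip_integrable.
  by apply: eq_Rintegral => x _; case: (g x) (h x) => a b [p q] /=; ring.
rewrite -RintegralB //; try exact: rip_integrable.
by apply: eq_Rintegral => x _; case: (g x) (h x) => a b [p q] /=; ring.
Qed.

Definition L2b : {pred (T -> C^o)} := fun g => `[< L2 mu g >].

Lemma L2b_submod : submod_closed L2b.
Proof.
split; first exact/asboolP/L2_0.
by move=> a g h /asboolP hg /asboolP hh; apply/asboolP; exact: L2_lin.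
Qed.

HB.instance Definition _ := GRing.isSubmodClosed.Build C (T -> C^o) L2b L2b_submod.

Record L2T := L2Sub { L2val :> T -> C^o; L2valP : L2val \in L2b }.
HB.instance Definition _ := [isSub for L2val].
HB.instance Definition _ := [Choice of L2T by <:].
HB.instance Definition _ := [SubChoice_isSubLmodule of L2T by <:].

Lemma L2T_L2 (g : L2T) : L2 mu g.
Proof. by apply/asboolP; exact: L2valP. Qed.
Definition toL2 g (hg : L2 mu g) : L2T := L2Sub (asboolT hg).
Definition ipL2 (g h : L2T) : C := inner mu g h.

Lemma ipL2E (g h : L2T) : ipL2 g h =
  Complex (rip mu (Re g) (Re h) + rip mu (Im g) (Im h))
          (rip mu (Im g) (Re h) - rip mu (Re g) (Im h)).
Proof. by apply: innerE; exact: L2T_L2. Qed.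

Lemma L2T_re (g : L2T) : Re g \in Lfun mu 2%:E. Proof. by case: (L2T_L2 g). Qed.
Lemma L2T_im (g : L2T) : Im g \in Lfun mu 2%:E. Proof. by case: (L2T_L2 g). Qed.

Lemma ipL2D (x y z : L2T) : ipL2 (x + y) z = ipL2 x z + ipL2 y z.
Proof.
have E (u v w : T -> R) : u \in Lfun mu 2%:E -> v \in Lfun mu 2%:E -> w \in Lfun mu 2%:E ->
    rip mu (fun t => u t + v t) w = rip mu u w + rip mu v w.
  move=> hu hv hw; rewrite -[rip mu u w]mul1r -[rip mu v w]mul1r -rip_linl //.
  by congr (rip mu _ w); apply/funext => t; rewrite !mul1r.
have ER : Re (x + y) = fun t => complex.Re (x t) + complex.Re (y t) by apply/funext => t; exact: ReD.
have EI : Im (x + y) = fun t => complex.Im (x t) + complex.Im (y t) by apply/funext => t; exact: ImD.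
rewrite !ipL2E ER EI !E ?L2T_re ?L2T_im //.
apply/eqP; rewrite eq_complex /=; apply/andP; split; apply/eqP; ring.
Qed.

Lemma ipL2Z (a : C) (x z : L2T) : ipL2 (a *: x) z = a * ipL2 x z.
Proof.
have ER : Re (a *: x) = fun t => complex.Re a * complex.Re (x t) + (- complex.Im a) * complex.Im (x t).
  by apply/funext => t; apply: etrans (ReM a (x t)) _; rewrite mulNr.
have EI : Im (a *: x) = fun t => complex.Re a * complex.Im (x t) + complex.Im a * complex.Re (x t).
  by apply/funext => t; exact: ImM.
rewrite !ipL2E ER EI !rip_linl ?L2T_re ?L2T_im //.
by apply/eqP; rewrite eq_complex ReM ImM /=; apply/andP; split; apply/eqP; ring.
Qed.

Lemma ipL2C (x y : L2T) : ipL2 y x = (ipL2 x y)^*.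
Proof.
rewrite !ipL2E ![rip mu (fun=> _ (y _)) _]ripC.
by apply/eqP; rewrite eq_complex /=; apply/andP; split; apply/eqP; ring.
Qed.

Lemma ipL2_self (x : L2T) : ipL2 x x = (rip mu (Re x) (Re x) + rip mu (Im x) (Im x))%:C%C.
Proof. by rewrite ipL2E ripC subrr. Qed.

Lemma ipL2_ge0 (x : L2T) : 0 <= ipL2 x x.
Proof. by rewrite ipL2_self ler0c addr_ge0 // rip_ge0. Qed.

Lemma ipL2_complete (x : nat -> L2T) :
  (forall eps : R, 0 < eps -> exists N, forall m n, (N <= m)%N -> (N <= n)%N ->
     complex.Re (ipL2 (x m - x n) (x m - x n)) < eps) ->
  exists l, forall eps : R, 0 < eps -> exists N, forall n, (N <= n)%N ->
     complex.Re (ipL2 (x n - l) (x n - l)) < eps.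
Proof.
move=> cauchy.
have E (y z : L2T) : complex.Re (ipL2 (y - z) (y - z)) =
    rip mu (fun t => complex.Re (y t) - complex.Re (z t)) (fun t => complex.Re (y t) - complex.Re (z t))
    + rip mu (fun t => complex.Im (y t) - complex.Im (z t)) (fun t => complex.Im (y t) - complex.Im (z t)).
  have ER : Re (y - z) = fun t => complex.Re (y t) - complex.Re (z t).
    by apply/funext => t; exact: ReB.
  have EI : Im (y - z) = fun t => complex.Im (y t) - complex.Im (z t).
    by apply/funext => t; exact: ImB.
  by rewrite ipL2_self ER EI.
have [l1 hl1 cl1] : exists2 l, l \in Lfun mu 2%:E & forall eps : R, 0 < eps -> exists N, forall n, (N <= n)%N ->
    rip mu (fun t => complex.Re (x n t) - l t) (fun t => complex.Re (x n t) - l t) < eps.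
  apply: rip_complete => [n|eps /cauchy[N hN]]; first exact: L2T_re.
  exists N => m n Nm Nn; apply: le_lt_trans (hN _ _ Nm Nn).
  by rewrite E lerDl rip_ge0.
have [l2 hl2 cl2] : exists2 l, l \in Lfun mu 2%:E & forall eps : R, 0 < eps -> exists N, forall n, (N <= n)%N ->
    rip mu (fun t => complex.Im (x n t) - l t) (fun t => complex.Im (x n t) - l t) < eps.
  apply: rip_complete => [n|eps /cauchy[N hN]]; first exact: L2T_im.
  exists N => m n Nm Nn; apply: le_lt_trans (hN _ _ Nm Nn).
  by rewrite E lerDr rip_ge0.
have lL2 : L2 mu (fun t => Complex (l1 t) (l2 t)) by [].
exists (toL2 lL2) => eps e0; have e2 : 0 < eps / 2 by rewrite divr_gt0.
have [N1 h1] := cl1 _ e2; have [N2 h2] := cl2 _ e2.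
exists (maxn N1 N2) => n; rewrite geq_max => /andP[/h1 {}h1 /h2 {}h2].
by rewrite E /=; lra.
Qed.

Definition L2_semiHilbert : semiHilbert L2T :=
  SemiHilbert ipL2D ipL2Z ipL2C ipL2_ge0 ipL2_complete.

End ComplexL2.

(** * From functions to vectors *)

Section Transport.
Context (R : realType) (d : measure_display) (T : measurableType d).
Variable mu : probability T R.
Local Notation C := R[i].
Local Notation ip := (L2_semiHilbert mu).
Implicit Types (g h : L2T mu) (E : set (T -> C)).

Lemma sqrtC_toC (x : R) : 0 <= x -> sqrtC (x%:C%C : C) = (Num.sqrt x)%:C%C.
Proof.
move=> x0; rewrite -[in LHS](sqr_sqrtr x0) rmorphXn /= sqrCK //.
by rewrite ler0c sqrtr_ge0.
Qed.

Lemma L2norm_val g : L2norm mu g = (Num.sqrt (sqn ip g))%:C%C.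
Proof. by rewrite -sqrtC_toC ?sqn_ge0 // -ipE. Qed.

Lemma L2norm_lt g (eps : R) : 0 < eps -> (L2norm mu g < eps%:C%C) = (sqn ip g < eps ^+ 2).
Proof.
move=> e0; rewrite L2norm_val ltcR -[X in _ < X](ger0_norm (ltW e0)) -sqrtr_sqr.
by rewrite ltr_sqrt // exprn_gt0.
Qed.

Lemma val_comb (fT : nat -> L2T mu) n (I : pred nat) (c : nat -> C) x :
  (\sum_(k < n | I k) c k *: fT k : L2T mu) x = \sum_(k < n | I k) c k * fT k x.
Proof.
by elim/big_rec2: _ => [//|k y z _ <-].
Qed.

Lemma sqn_ae0 g : sqn ip g = 0 <-> {ae mu, forall x, g x = 0}.
Proof.
have qE : sqn ip g = rip mu (fun x => complex.Re (g x)) (fun x => complex.Re (g x))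
    + rip mu (fun x => complex.Im (g x)) (fun x => complex.Im (g x)).
  by rewrite /sqn [X in complex.Re X]ipL2_self.
rewrite qE; split.
  move/eqP; rewrite paddr_eq0 ?rip_ge0 // => /andP[/eqP h1 /eqP h2].
  have := rip_eq0_ae (L2T_im g) h2; have := rip_eq0_ae (L2T_re g) h1.
  apply: filterS2 => x; by case: (g x) => a b /= -> ->.
move=> h; have r0 (u : T -> R) : u \in Lfun mu 2%:E -> {ae mu, forall x, u x = 0} -> rip mu u u = 0.
  move=> hu u0; have : (rip mu u u)%:E = 0%E.
    rewrite -rip_EFin // -[RHS](integral0 mu setT); apply: ae_eq_integral => //.
      by apply/measurable_EFinP; apply: measurable_funX; exact: (lfun2_measurable hu).
    by apply: filterS u0 => x -> _; rewrite expr0n.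
  by case.
rewrite !r0 ?addr0 ?L2T_re ?L2T_im //; apply: filterS h => x ->; by [].
Qed.

(** E and ET are the same set of square integrable functions, as a set of
    functions and as a set of vectors. *)
Definition models E (ET : set (L2T mu)) :=
  (forall u : T -> C, E u -> L2 mu u) /\ (forall g, E g <-> ET g).

Definition projT E g : L2T mu := xget (0 : L2T mu) [set p : L2T mu | (p : T -> C) = Defs.proj mu E g].

Lemma projTP E ET : models E ET -> subspace ET -> qclosed ip ET -> forall g,
  projT E g = Defs.proj mu E g :> (T -> C) /\ is_proj ip ET g (projT E g).
Proof.
move=> [EL EE] sE cE g.
have [p [pE po]] := proj_exists (ip := ip) g sE cE.
have hproj : E (Defs.proj mu E g) /\ forall e, E e -> inner mu (fun x => g x - Defs.proj mu E g x) e = 0.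
  rewrite /Defs.proj; case: xgetP => [y _ //|/(_ (p : T -> C))[]]; split; first exact/EE.
  move=> e eE; have eT : ET (toL2 (EL e eE)) by apply/EE. exact: po eT.
have pT : (projT E g : T -> C) = Defs.proj mu E g.
  rewrite /projT; case: xgetP => [y _ //|/(_ (toL2 (EL _ hproj.1)))[]]; by [].
split=> //; split; first by apply/EE; rewrite pT; case: hproj.
move=> e /EE eE; have := hproj.2 _ eE; by rewrite -pT.
Qed.

Definition DeltaT E1 E2 g : L2T mu := g - projT E1 (projT E2 (projT E1 g)).

Lemma DeltaE E1 E2 ET1 ET2 : models E1 ET1 -> subspace ET1 -> qclosed ip ET1 ->
  models E2 ET2 -> subspace ET2 -> qclosed ip ET2 ->
  forall g, Delta mu E1 E2 g = DeltaT E1 E2 g :> (T -> C).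
Proof.
move=> m1 s1 c1 m2 s2 c2 g; apply/funext => x; rewrite /Delta.
have p1 := projTP m1 s1 c1; have p2 := projTP m2 s2 c2.
by rewrite -(p1 g).1 -(p2 _).1 -(p1 _).1.
Qed.

Lemma has_detP (A : (T -> C) -> T -> C) (AT : L2T mu -> L2T mu) z :
  (forall g, A g = AT g :> (T -> C)) -> has_det mu A z <-> det_repr ip AT z.
Proof.
move=> AE.
have comb n (e : 'I_n -> L2T mu) (c : 'I_n -> C) x :
    (\sum_(i < n) c i *: e i : L2T mu) x = \sum_(i < n) c i * e i x.
  by elim/big_rec2: _ => [//|k y w _ <-].
split=> [[n [e [eL eo eB ->]]]|[n [e [eo eB ->]]]]; exists n.
  exists (fun i => toL2 (eL i)); split => //.
    move=> g; apply/sqn_ae0; apply: filterS (eB g (L2T_L2 g)) => x.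
    rewrite AE => h; have -> : (AT g - g - \sum_i ip (AT g - g) (toL2 (eL i)) *: toL2 (eL i) : L2T mu) x
      = (AT g x - g x) - (\sum_i ip (AT g - g) (toL2 (eL i)) *: toL2 (eL i) : L2T mu) x by [].
    by rewrite comb h subrr.
  by congr (\det _); apply/matrixP => i j; rewrite !mxE (AE (toL2 (eL j))).
exists (fun i => e i : T -> C); split => //.
- by move=> i; exact: L2T_L2.
- move=> g gL; have /sqn_ae0 := eB (toL2 gL); apply: filterS => x.
  rewrite (AE (toL2 gL)) => h; apply/eqP; rewrite -subr_eq0 -[X in _ == X]h; apply/eqP.
  have -> : (AT (toL2 gL) - toL2 gL - \sum_i ip (AT (toL2 gL) - toL2 gL) (e i) *: e i : L2T mu) x
      = (AT (toL2 gL) x - g x) - (\sum_i ip (AT (toL2 gL) - toL2 gL) (e i) *: e i : L2T mu) x by [].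
  by rewrite comb.
- by congr (\det _); apply/matrixP => i j; rewrite !mxE AE.
Qed.

Lemma detL2_eq A (z0 : C) : (forall z, has_det mu A z <-> z = z0) -> detL2 mu A = z0.
Proof.
move=> h; rewrite /detL2; case: xgetP => [y _ /h //|/(_ z0) []]; exact/h.
Qed.

Section Process.
Variable f : nat -> T -> C.
Hypothesis fL : forall n, L2 mu (f n).
Definition fT n : L2T mu := toL2 (fL n).

Lemma models_closed_span (I : pred nat) : models (closed_span mu f I) (cspan ip fT I).
Proof.
split=> [h []//|g]; split.
  move=> [_ h] eps e0; have s0 : 0 < (Num.sqrt eps)%:C%C :> C by rewrite ltcR sqrtr_gt0.
  have [n [c hc]] := h _ s0; exists n, c; move: hc.
  have -> : (fun x => g x - \sum_(k < n | I k) c k * f k x)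
     = (g - \sum_(k < n | I k) c k *: fT k : L2T mu) :> (T -> C).
    apply/funext => x; apply: (congr1 (fun w => g x - w)).
    exact: esym (val_comb fT n I c x).
  by rewrite L2norm_lt ?sqrtr_gt0 // sqr_sqrtr // ltW.
move=> h; split; first exact: L2T_L2.
move=> eps /toC_pos[e e0 ->]; have e2 : 0 < e ^+ 2 by rewrite exprn_gt0.
have [n [c hc]] := h _ e2; exists n, c; move: hc.
have -> : (fun x => g x - \sum_(k < n | I k) c k * f k x)
     = (g - \sum_(k < n | I k) c k *: fT k : L2T mu) :> (T -> C).
  apply/funext => x; apply: (congr1 (fun w => g x - w)).
    exact: esym (val_comb fT n I c x).
by rewrite L2norm_lt.
Qed.

Lemma eq_cspan (I J : pred nat) : I =1 J -> cspan ip fT I = cspan ip fT J.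
Proof. by move/funext ->. Qed.

Lemma detL2_Delta (I J Q : pred nat) r m :
  I =1 (fun k => (r <= k) && (k < r + m))%N ->
  J =1 (fun k => (r + m <= k)%N && Q k) ->
  (forall k, (k < r + m)%N -> Q k) ->
  (forall l, 0 < pred_err ip fT xpredT l) ->
  detL2 mu (Delta mu (closed_span mu f I) (closed_span mu f J))
  = (\prod_(l < m) pred_err ip fT Q (r + l) /
     \prod_(l < m) pred_err ip fT (below (r + m)) (r + l))%:C%C.
Proof.
move=> hI hJ hQ hw; have m1 := models_closed_span I; have m2 := models_closed_span J.
have s1 := cspan_subspace ip fT I; have c1 := @cspan_closed _ _ ip fT I.
have s2 := cspan_subspace ip fT J; have c2 := @cspan_closed _ _ ip fT J.
have hw' (Q' : pred nat) l : pred_err ip fT Q' l != 0.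
  by rewrite gt_eqF //; apply: lt_le_trans (hw l) _; exact: pred_err_mono.
apply: detL2_eq => z; apply: (iff_trans (has_detP _ (DeltaE m1 s1 c1 m2 s2 c2))).
have E1 : cspan ip fT I = tail ip fT (below (r + m)) r by exact: eq_cspan.
have E2 : cspan ip fT J = tail ip fT Q (r + m) by exact: eq_cspan.
apply: det_sandwich_pred_err => //.
- by move=> l /andP[_ /hQ].
- by move=> x; have [_] := projTP m1 s1 c1 x; rewrite E1.
- by move=> x; have [_] := projTP m2 s2 c2 x; rewrite E2.
Qed.

Lemma detL2_Delta1 (I J Q : pred nat) r :
  I =1 (fun k => (r <= k <= r)%N) -> J =1 (fun k => (r < k)%N && Q k) ->
  (forall k, (k <= r)%N -> Q k) ->
  (forall l, 0 < pred_err ip fT xpredT l) ->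
  detL2 mu (Delta mu (closed_span mu f I) (closed_span mu f J))
  = (pred_err ip fT Q r / pred_err ip fT (below r.+1) r)%:C%C.
Proof.
move=> hI hJ hQ hw.
have hI' : I =1 (fun k => (r <= k) && (k < r + 1))%N.
  by move=> k; rewrite hI addn1 ltnS.
have hJ' : J =1 (fun k => (r + 1 <= k)%N && Q k) by move=> k; rewrite addn1 hJ.
have hQ' k : (k < r + 1)%N -> Q k by rewrite addn1 ltnS; exact: hQ.
rewrite (detL2_Delta hI' hJ' hQ' hw).
by rewrite !big_ord1 addn0 addn1.
Qed.

Lemma Ddet_innov s r m q : (forall i j, s i j = gramK ip fT i j) -> (q.+1 - r = m)%N ->
  (forall l, 0 < pred_err ip fT xpredT l) ->
  Ddet s r q = (\prod_(l < m) pred_err ip fT (below (r + m)) (r + l))%:C%C.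
Proof.
move=> hs <- hw; set n := (q.+1 - r)%N.
have hw' (Q' : pred nat) l : pred_err ip fT Q' l != 0.
  by rewrite gt_eqF //; apply: lt_le_trans (hw l) _; exact: pred_err_mono.
have p0 x : is_proj ip (tail ip fT (below (r + n)) (r + n)) x 0.
  split; first by case: (tail_subspace ip fT (below (r + n)) (r + n)).
  by apply: cspan_orth => k /andP[/= mk]; rewrite /below /= ltnNge mk.
rewrite -(gram_pred_err (p := fun=> 0) (Q := below (r + n))) //; last by move=> l /andP[].
congr (\det _); apply/matrixP => i j; rewrite !mxE hs /gramK.
by rewrite !subr0.
Qed.

(** P_{0,n} tends to the projection on the whole span, which is the identity as
    the process is total, and P_{n+1,oo} decreases to the projection on the remote
    future. *)
Lemma Delta_strong_cvg : (forall g : T -> C, L2 mu g -> Hspan_inf mu f 0 g) ->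
  strong_cvg mu (fun n => Delta mu (Hspan mu f 0 n) (Hspan_inf mu f n.+1))
    (Delta mu (Hspan_inf mu f 0) (\bigcap_n Hspan_inf mu f n)).
Proof.
move=> tot.
pose I1 n : pred nat := [pred k | (0 <= k <= n)%N].
pose I2 n : pred nat := [pred k | (n.+1 <= k)%N].
pose I0 : pred nat := [pred k | (0 <= k)%N].
pose E1 n := cspan ip fT (I1 n); pose E2 n := cspan ip fT (I2 n).
pose Ei := \bigcap_n E2 n.
have m1 n : models (Hspan mu f 0 n) (E1 n) by exact: (models_closed_span (I1 n)).
have m2 n : models (Hspan_inf mu f n.+1) (E2 n) by exact: (models_closed_span (I2 n)).
have m0 : models (Hspan_inf mu f 0) (cspan ip fT I0) by exact: (models_closed_span I0).
have s1 n : subspace (E1 n) by exact: cspan_subspace.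
have s2 n : subspace (E2 n) by exact: cspan_subspace.
have s0 : subspace (cspan ip fT I0) by exact: cspan_subspace.
have c1 n : qclosed ip (E1 n) by exact: cspan_closed.
have c2 n : qclosed ip (E2 n) by exact: cspan_closed.
have c0 : qclosed ip (cspan ip fT I0) by exact: cspan_closed.
have dec m n : (m <= n)%N -> E2 n `<=` E2 m.
  by move=> mn; apply: cspan_mono => k /= nk; apply: leq_trans nk; rewrite ltnS.
have mi : models (\bigcap_n Hspan_inf mu f n) Ei.
  split=> [u hu|g]; first by have [] := hu 0%N I.
  split=> [hu n _|hu n _]; first by apply/(m2 n).2; exact: hu.
  case: n => [|n]; last by apply/(m2 n).2; exact: hu.
  by apply: tot; exact: L2T_L2.
have si : subspace Ei.
  split=> [n _|a u v hu hv n _]; first by case: (s2 n).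
  by case: (s2 n) => _; apply; [exact: hu|exact: hv].
have ci : qclosed ip Ei.
  move=> u hu n _; apply: c2 => eps /hu[y yE hy]; exists y => //; exact: yE.
pose P1 n := projT (Hspan mu f 0 n); pose P2 n := projT (Hspan_inf mu f n.+1).
pose P0 := projT (Hspan_inf mu f 0); pose Pi := projT (\bigcap_n Hspan_inf mu f n).
have h1 n x : is_proj ip (E1 n) x (P1 n x) by exact: (projTP (m1 n) (s1 n) (c1 n) x).2.
have h2 n x : is_proj ip (E2 n) x (P2 n x) by exact: (projTP (m2 n) (s2 n) (c2 n) x).2.
have h0 x : is_proj ip (cspan ip fT I0) x (P0 x) by exact: (projTP m0 s0 c0 x).2.
have hi x : is_proj ip Ei x (Pi x) by exact: (projTP mi si ci x).2.
have full x : cspan ip fT I0 x by apply/m0.2; apply: tot; exact: L2T_L2.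
have up x : qcvg ip (P1 ^~ x) x.
  apply: (qcvg_proj_increasing s1 (h1 ^~ x)) => eps e0.
  have [N [c hc]] := full x _ e0; exists N => n Nn.
  exists (\sum_(k < N | I0 k) c k *: fT k) => //.
  rewrite (_ : \sum_(k < N | I0 k) _ = \sum_(k < N | I1 n k) c k *: fT k); first exact: cspan_comb.
  by apply: eq_bigl => k; rewrite /I0 /I1 /= (leq_trans (ltnW (ltn_ord k)) Nn).
have null0 x : sqn ip (P0 x - x) = 0.
  by apply: (proj_uniq s0 (h0 x)); split => // e _; rewrite subrr ip0l.
move=> g gL; pose gT := toL2 gL.
have lim : qcvg ip (fun n => P1 n (P2 n (P1 n gT))) (P0 (Pi (P0 gT))).
  exact: (qcvg_sandwich gT s1 s2 c2 dec h1 h2 hi up null0).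
apply/cvgCP => eps e0; have e2 : 0 < eps ^+ 2 by rewrite exprn_gt0.
have [N hN] := lim _ e2; exists N => n /hN {}hN.
have -> : (fun x => Delta mu (Hspan mu f 0 n) (Hspan_inf mu f n.+1) g x
      - Delta mu (Hspan_inf mu f 0) (\bigcap_n Hspan_inf mu f n) g x)
    = (P0 (Pi (P0 gT)) - P1 n (P2 n (P1 n gT)) : L2T mu) :> (T -> C).
  apply/funext => x.
  rewrite (DeltaE (m1 n) (s1 n) (c1 n) (m2 n) (s2 n) (c2 n) gT).
  rewrite (DeltaE m0 s0 c0 mi si ci gT).
  have cancel (a b c : C) : (a - b) - (a - c) = c - b by ring.
  exact: cancel.
by rewrite sub0r normrN ger0_norm ?L2norm_lt 1?sqnBC // L2norm_val ler0c sqrtr_ge0.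
Qed.

End Process.
End Transport.

(** * Prediction errors of the process and the theorem *)

Lemma prod_nat_split (R : comNzRingType) (u : nat -> R) m N :
  \prod_(1 <= j < (m + N).+1) u j = (\prod_(1 <= j < m.+1) u j) * \prod_(i < N) u (m.+1 + i)%N.
Proof.
elim: N => [|N IH]; first by rewrite addn0 big_ord0 mulr1.
by rewrite addnS big_nat_recr //= IH big_ord_recr /= mulrA addSn.
Qed.

Section Prediction.
Context (R : realType) (dsp : measure_display) (Omega : measurableType dsp).
Variable mu : probability Omega R.
Local Notation C := R[i].
Local Notation ip := (L2_semiHilbert mu).
Context (f : nat -> Omega -> C) (fL : forall n, L2 mu (f n)).
Context (s g : nat -> nat -> C).
Hypothesis sg : is_parameters s g.
Hypothesis sE : forall i j, s i j = gramK ip (fT fL) i j.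
Hypothesis wpos : forall l, 0 < pred_err ip (fT fL) xpredT l.

Let err (q r : nat) : R := pred_err ip (fT fL) (below q.+1) r.
Let W (r : nat) : R := pred_err ip (fT fL) xpredT r.

Lemma err_gt0 q r : 0 < err q r.
Proof. by apply: lt_le_trans (wpos r) _; exact: pred_err_mono. Qed.

Lemma moment_herm i j : s j i = (s i j)^*.
Proof. by rewrite !sE /gramK -ipC. Qed.

Lemma moment_ge0 i : 0 <= s i i.
Proof. by rewrite sE; exact: ip_ge0. Qed.

Lemma Ddet_neq0 r q : Ddet s r q != 0.
Proof.
rewrite (Ddet_innov sE (erefl _) wpos) (inj_eq (@complexI _) _ 0).
apply/prodf_neq0 => l _; rewrite gt_eqF //; apply: lt_le_trans (wpos _) _.
exact: pred_err_mono.
Qed.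

Lemma Ddet_err r m : Ddet s r (r + m) / Ddet s r.+1 (r + m) = (err (r + m) r)%:C%C.
Proof.
have D0 := Ddet_neq0 r.+1 (r + m).
have e1 : ((r + m).+1 - r = m.+1)%N by rewrite -addnS addKn.
have e2 : ((r + m).+1 - r.+1 = m)%N by rewrite subSS addKn.
have H1 := Ddet_innov sE e1 wpos; have H2 := Ddet_innov sE e2 wpos.
rewrite addnS in H1; rewrite addSn in H2.
apply: (canLR (mulfK D0)); rewrite H1 H2 -rmorphM; apply: (congr1 (real_complex R)).
rewrite big_ord_recl addn0; apply: (congr1 (fun x => err (r + m) r * x)).
by apply: eq_bigr => l _; rewrite lift0 addnS -addSn.
Qed.

Lemma err_defect r m :
  s r r * \prod_(1 <= j < m.+1) defect g r (r + j)%N ^+ 2 = (err (r + m) r)%:C%C.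
Proof.
rewrite -Ddet_err (Ddet_ratio_parameters sg) //; first exact: moment_herm.
- exact: moment_ge0.
- exact: Ddet_neq0.
Qed.

Lemma err_self r : (err r r)%:C%C = s r r.
Proof. by have := err_defect r 0; rewrite addn0 big_geq // mulr1 => <-. Qed.

Lemma err_cvg r : (fun q => (err q r)%:C%C : C) @ \oo --> ((W r)%:C%C : C).
Proof.
apply: cvg_toC; apply/cvgRP => eps e0.
have [N hN] := pred_err_limit ip (fT fL) r e0; exists N => q Nq.
have h1 : W r <= err q r by exact: pred_err_mono.
have h2 : err q r < W r + eps by apply: hN; exact: leqW.
by move: h1 h2; move: (W r) (err q r) => a b h1 h2; rewrite distrC ger0_norm; lra.
Qed.

Lemma Ddet_cvg r : (fun q => Ddet s r q / Ddet s r.+1 q) @ \oo --> ((W r)%:C%C : C).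
Proof.
apply/cvgCP => eps e0; have /cvgCP/(_ _ e0)[N hN] := @err_cvg r.
exists (maxn N r) => q; rewrite geq_max => /andP[/hN + rq].
by rewrite -(subnKC rq) Ddet_err.
Qed.

Lemma err_defect_cvg r :
  (fun n => s r r * \prod_(1 <= j < n.+1) defect g r (r + j)%N ^+ 2) @ \oo --> ((W r)%:C%C : C).
Proof.
apply/cvgCP => eps e0; have /cvgCP/(_ _ e0)[N hN] := @err_cvg r.
by exists N => n Nn; rewrite err_defect; apply: hN; rewrite (leq_trans Nn) // leq_addl.
Qed.

(** The partial product up to N is e(k, n + N) / e(k, n), by [err_defect] at the
    two ends. *)
Lemma infprod_err k n : (k <= n)%N ->
  infprod (fun i => defect g k (n.+1 + i)%N ^+ 2) = (W k / err n k)%:C%C.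
Proof.
move=> kn; apply: limC_eq.
have -> : (fun N => \prod_(i < N) defect g k (n.+1 + i)%N ^+ 2)
    = fun N => ((err (n + N) k)%:C%C : C) / (err n k)%:C%C.
  apply/funext => N.
  have e1 := err_defect k (n - k + N); have e2 := err_defect k (n - k).
  have n0 : (err n k)%:C%C != 0 :> C by rewrite (inj_eq (@complexI _) _ 0) gt_eqF // err_gt0.
  rewrite addnA subnKC // prod_nat_split in e1; rewrite subnKC // in e2.
  move: e1 e2 n0; move: (err (n + N) k) (err n k) => a b <- <- n0.
  rewrite mulrA mulrAC divff // mul1r; apply: eq_bigr => i _.
  by congr (defect g _ _ ^+ _); rewrite addSn addnS addnA subnKC.
rewrite rmorphM /= rmorphV /=; last by rewrite unitfE gt_eqF // err_gt0.
apply: cvgMl; apply/cvgCP => eps e0; have /cvgCP/(_ _ e0)[N hN] := @err_cvg k.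
by exists N => m Nm; apply: hN; rewrite (leq_trans Nm) // leq_addl.
Qed.

Lemma ophi_sharp_err r m :
  1 / `|(ophi_sharp s g m r).[0]| ^+ 2 = (err (r + m) r)%:C%C.
Proof.
rewrite div1r -err_defect ophi_sharp0 normrM exprMn invfM.
have s0 : 0 < s r r by rewrite -err_self ltcR err_gt0.
congr (_ * _); first by rewrite normfV exprVn invrK ger0_norm ?sqrtC_ge0 ?sqrtCK // ltW.
rewrite normr_prod -prodrXl -prodfV !big_nat; apply: eq_bigr => j /andP[j1 _].
rewrite normfV exprVn invrK ger0_norm // ltW // (defect_gt0 (g := g)) //.
  by move=> k l /sg[].
by rewrite -[X in (X < _)%N]addn0 ltn_add2l.
Qed.

End Prediction.

Theorem theorem3p4
  (R : realType)
  (phi : {scalar P2 R}) (hphi : strictly_positive phi)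
  (gamma : nat -> nat -> R[i]) (hgamma : is_parameters (moment phi) gamma)
  (F : pred nat) (Theta : nat -> nat -> R[i])
  (hTheta : spectral_factor (moment phi) F Theta)
  (hSzego : szego_class Theta)
  (dsp : measure_display) (Omega : measurableType dsp)
  (mu : probability Omega R) (f : nat -> Omega -> R[i])
  (hf : is_process mu (moment phi) f) :
  let s := moment phi in
  let D := Ddet s in
  let d := defect gamma in
  let H := Hspan mu f in
  let Hinf := Hspan_inf mu f in
  let g (r : nat) := limn (fun q => D r q / D r.+1 q) in
  [/\ (forall r q, (r < q)%N ->
         D r q / D r.+1 q
           = s r r * detL2 mu (Delta mu (H r r) (H r.+1 q)) /\
         s r r * detL2 mu (Delta mu (H r r) (H r.+1 q))
           = 1 / `|(ophi_sharp s gamma (q - r) r).[0]| ^+ 2),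
      (forall r,
         [/\ (fun q => D r q / D r.+1 q) @ \oo
               --> s r r * detL2 mu (Delta mu (H r r) (Hinf r.+1)),
             s r r * detL2 mu (Delta mu (H r r) (Hinf r.+1))
               = `|Theta r r| ^+ 2 &
             (fun n => s r r * \prod_(1 <= j < n.+1) d r (r + j)%N ^+ 2) @ \oo
               --> `|Theta r r| ^+ 2])
    & (forall L : R[i], 0 < L ->
         (fun n => \prod_(k < n.+1) infprod (fun i => d k (n.+1 + i)%N ^+ 2))
           @ \oo --> L ->
         exists delta : R[i],
           [/\ has_det_along mu (fun n => Delta mu (H 0%N n) (Hinf n.+1))
                 (Delta mu (Hinf 0%N) (\bigcap_n Hinf n)) delta,
               (fun n => D 0%N n / \prod_(l < n.+1) g l) @ \oo --> 1 / delta &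
               1 / delta = 1 / L])].
Proof.
move=> s D d H Hinf g; have [fL fK ftot] := hf.
pose ip := L2_semiHilbert mu.
have sE i j : s i j = gramK ip (fT fL) i j by exact: fK.
have KE : moment phi = gramK ip (fT fL) by apply/funext => i; apply/funext => j; exact: sE.
have thE r : `|Theta r r| ^+ 2 = (pred_err ip (fT fL) xpredT r)%:C%C.
  by rewrite pred_errE; apply: (spectral_factor_innov (F := F)); rewrite -KE.
have wpos r : 0 < pred_err ip (fT fL) xpredT r.
  by rewrite -ltcR -thE exprn_gt0 // normr_gt0 gt_eqF.
have detE r (J Q : pred nat) : J =1 (fun k => (r.+1 <= k)%N && Q k) ->
    (forall k, (k < r.+1)%N -> Q k) ->
    s r r * detL2 mu (Delta mu (H r r) (closed_span mu f J))
    = (pred_err ip (fT fL) Q r)%:C%C.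
  move=> hJ hQ; rewrite (@detL2_Delta1 _ _ _ _ _ fL _ J Q r) //.
  have -> : s r r = (pred_err ip (fT fL) (below r.+1) r)%:C%C.
    exact: esym (err_self hgamma sE wpos r).
  rewrite -rmorphM; apply: (congr1 (real_complex R)).
  by rewrite mulrC divfK // gt_eqF // (err_gt0 wpos).
split.
- move=> r q rq; rewrite (detE r _ (below q.+1)) //; last first.
    by move=> k kr; exact: leq_trans kr (leqW rq).
  rewrite -{1 2 3 4}(subnKC (ltnW rq)) Ddet_err //; split => //.
  by rewrite (ophi_sharp_err hgamma sE wpos).
- move=> r; rewrite (detE r _ xpredT) //; last by move=> k /=; rewrite andbT.
  rewrite -thE; split => //; rewrite thE; first exact: Ddet_cvg.
  exact: err_defect_cvg.
move=> L L0 hL.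
have gE r : g r = (pred_err ip (fT fL) xpredT r)%:C%C by apply: limC_eq; exact: Ddet_cvg.
pose Pn n := \prod_(k < n.+1) infprod (fun i => d k (n.+1 + i)%N ^+ 2).
have PnE n : Pn n = (\prod_(k < n.+1) pred_err ip (fT fL) xpredT k /
     \prod_(k < n.+1) pred_err ip (fT fL) (below n.+1) k)%:C%C.
  rewrite /Pn -prodf_div rmorph_prod; apply: eq_bigr => k _.
  by rewrite (infprod_err hgamma sE wpos) // -ltnS.
have detn n : detL2 mu (Delta mu (H 0%N n) (Hinf n.+1)) = Pn n.
  have hI : [pred k | (0 <= k <= n)%N] =1 (fun k => (0 <= k) && (k < 0 + n.+1))%N by [].
  have hJ : [pred k | (n.+1 <= k)%N] =1 (fun k => (0 + n.+1 <= k)%N && xpredT k).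
    by move=> k; rewrite /= andbT.
  rewrite PnE; exact: (detL2_Delta hI hJ (fun k _ => isT) wpos).
have ratE n : D 0%N n / \prod_(l < n.+1) g l = (Pn n)^-1.
  have prod_neq0 (u : nat -> R) : (forall l, 0 < u l) -> \prod_(l < n.+1) u l != 0.
    by move=> h; apply/prodf_neq0 => l _; rewrite gt_eqF.
  have W0 := prod_neq0 _ wpos; have B0 := prod_neq0 _ (err_gt0 wpos n).
  rewrite PnE -fmorphV invf_div rmorphM fmorphV /=; apply: (congr2 (fun a b : R[i] => a / b)).
    exact: (Ddet_innov (m := n.+1) sE (subn0 _) wpos).
  by rewrite rmorph_prod; apply: eq_bigr => l _; exact: gE.
have hlim : (fun n => D 0%N n / \prod_(l < n.+1) g l) @ \oo --> 1 / L.
  rewrite (_ : (fun n => _) = fun n => (Pn n)^-1); last exact/funext.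
  by rewrite div1r; apply: cvgV; [rewrite gt_eqF|exact: hL].
exists L; split; [|exact: hlim|by []].
split; first exact: Delta_strong_cvg.
by rewrite (_ : (fun n => _) = Pn); [exact: hL|exact/funext].
Qed.
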